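(* Let $1 \leq t \leq k$ be integers, let $r$ be a non-negative integer with $r \leq k-t$, and let $m \geq 2k-t$. Let $\mathcal F$ be a $t$-intersecting family of $k$-multisets of $[m]$. 1. If $(k-t+1)\left(2+\frac{t-1}{r+1}\right) < m+k-1 < (k-t+1)\left(2+\frac{t-1}{r}\right)$ (with $\frac{t-1}{r}=\infty$ when $r=0$), then $|\mathcal F| \leq |\mathcal F_{(r)}|$. If $r>0$, equality holds if and only if $\mathcal F$ is isomorphic to $\mathcal F_{(r)}$. If $r=0$, equality holds if and only if $\mathcal F$ consists of all $k$-multisets of $[m]$ containing a fixed $t$-multiset. 2. If $m+k-1 = (k-t+1)\left(2+\frac{t-1}{r+1}\right)$, then $|\mathcal F| \leq |\mathcal F_{(r)}| = |\mathcal F_{(r+1)}|$. If $r>0$, equality holds if and only if $\mathcal F$ is isomorphic to $\mathcal F_{(r)}$ or to $\mathcal F_{(r+1)}$. If $r=0$, equality holds if and only if $\mathcal F$ is isomorphic to $\mathcal F_{(1)}$ or $\mathcal F$ consists of all $k$-multisets of $[m]$ containing a fixed $t$-multiset.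
   Context: A $k$-multiset of $[m]=\{1,\dots,m\}$ is a multiset of cardinality $k$ (counting repetitions) with elements from $[m]$; $\mathrm{m}(i,A)$ denotes the multiplicity of $i$ in $A$. The intersection of multisets $A,B$ is the multiset $C$ with $\mathrm{m}(i,C)=\min\{\mathrm{m}(i,A),\mathrm{m}(i,B)\}$ (a set is regarded as a multiset with all multiplicities one), and $|C|$ counts repetitions. A family is $t$-intersecting if $|A \cap B| \geq t$ for all members $A,B$. For integers $r \ge 0$, $\mathcal F_{(r)} = \{G \text{ a } k\text{-multiset of } [m] : |G \cap [t+2r]| \geq t+r\}$, where $[t+2r]=\{1,\dots,t+2r\}$. Two families are isomorphic if one is obtained from the other by a permutation of $[m]$.
   Formalization: In part 2 the equality |F_(r)| = |F_(r+1)| and the descriptions of the equality case are stated only for r < k−t; for r = k−t, where F_(r+1) is empty and the printed equality fails (e.g. k=t=1, m=2, r=0), only |F| ≤ |F_(r)| is claimed. *)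

(* Defs.v *)
From HB Require Import structures.
From mathcomp Require Import all_boot all_order all_fingroup all_algebra.
From mathcomp Require Import finmap multiset.

Set Implicit Arguments.
Unset Strict Implicit.
Unset Printing Implicit Defensive.

Local Open Scope fset_scope.
Local Open Scope mset_scope.
Local Open Scope nat_scope.

(* [m] = {1, ..., m} is 'I_m, the element i of [m] being the ordinal i - 1.
   For A : {mset 'I_m}, A i is the multiplicity of i in A.  The cardinality
   counting repetitions is size A (A coerces to its enumeration); in contrast,
   #|A| is the number of distinct elements of A. *)

Definition kmultisets (m k : nat) : {fset {mset 'I_m}} :=
  [fset seq_mset (val w) | w in {: k.-tuple 'I_m}]%fset.

Lemma in_kmultisets (m k : nat) (A : {mset 'I_m}) :
  (A \in kmultisets m k) = (size A == k).
Proof.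
apply/imfsetP/eqP => [[w _ ->]|sA].
  by rewrite (perm_size (perm_eq_seq_mset w)) size_tuple.
by exists (tcast sA (in_tuple A)); rewrite //= val_tcast /= seq_mset_id.
Qed.

Definition t_intersecting (m t : nat) (F : {fset {mset 'I_m}}) : Prop :=
  forall A B : {mset 'I_m}, A \in F -> B \in F -> t <= size (A `&` B)%mset.

(* The set [n] as a multiset over [m]; it is [n] itself when n <= m, and
   [n] intersected with [m] in general, which does not affect its
   intersection with multisets of [m]. *)
Definition initial_set (m n : nat) : {mset 'I_m} :=
  seq_mset [seq i : 'I_m <- enum 'I_m | i < n].

Definition frankl_family (m k t r : nat) : {fset {mset 'I_m}} :=
  [fset G in kmultisets m k
    | t + r <= size (G `&` initial_set m (t + 2 * r))%mset]%fset.

Definition permute_mset (m : nat) (s : {perm 'I_m}) (A : {mset 'I_m}) :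
    {mset 'I_m} :=
  seq_mset [seq s i | i <- A].

Definition isomorphic (m : nat) (F G : {fset {mset 'I_m}}) : Prop :=
  exists s : {perm 'I_m}, F = [fset permute_mset s A | A in G]%fset.

Definition all_containing_fixed (m k t : nat) (F : {fset {mset 'I_m}}) : Prop :=
  exists2 T : {mset 'I_m}, size T = t
    & F = [fset A in kmultisets m k | (T `<=` A)%mset]%fset.

(* (k - t + 1)(2 + (t - 1)/s), for s > 0 only: at s = 0 the intended value is
   +oo, whereas division by 0 in rat gives 0. *)
Definition threshold (k t s : nat) : rat :=
  ((k%:R - t%:R + 1) * (2%:R + (t%:R - 1) / s%:R))%R.

(* Main.v *)
(* Reflections of two multiplicities, (a, b) |-> (b + s, a - s) with s = 0 or 1,
   are shifts that keep a family of k-multisets t-intersecting.  Once a family is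
   stable under them, its supports are t-intersecting because m >= 2k - t.  As a
   set S is the support of as many k-multisets of [m] as it is the trace of
   k-subsets of [n], n = m + k - 1, the stable family becomes a compressed
   t-intersecting family of k-subsets of [n] that is at least as large.

   For these, the pushing argument of Ahlswede and Khachatrian shows that an
   optimal compressed family is invariant under permutations of [t + 2r], and,
   applied to the family of complements, under permutations of the rest of [n]
   (of all but two elements of the rest, at the threshold).  Only the families
   F_(r), and F_(r+1) at the threshold, are left.  The equality cases are then
   pulled back through the shifts one at a time. *)
Require Import Defs.
From mathcomp Require Import all_boot all_order all_fingroup all_algebra.
From mathcomp Require Import finmap multiset.
From mathcomp Require Import zify.
Set Implicit Arguments.
Unset Strict Implicit.
Unset Printing Implicit Defensive.
Local Open Scope fset_scope.
Local Open Scope mset_scope.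
Local Open Scope nat_scope.

(* Boolean hypotheses make [lia] split on every membership atom, and it can
   fail to identify convertible cardinals or multiplicities: the two tactics
   below clear the former and generalize the latter. *)
Ltac mlia :=
  repeat match goal with
  | H : is_true (_ \in _) |- _ => clear H
  | H : is_true (~~ (_ \in _)) |- _ => clear H
  | H : is_true (_ \subset _) |- _ => clear H
  | H : forall _, _ |- _ => clear H
  | H := _ |- _ => clearbody H
  end;
  repeat match goal with H : context [card _] |- _ => revert H end;
  repeat match goal with
    |- context [@card ?T ?A] => let c := fresh "c" in move: (@card T A) => c
  end;
  intros; lia.

Ltac olia :=
  repeat match goal with
    |- context [nat_of_ord ?a] => let c := fresh "c" in move: (nat_of_ord a) => c
  end; lia.

(** * Exchanging elements of a finite set *)

Section Swap.
Variable T : finType.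
Implicit Types (A B C Y : {set T}) (x y z e : T) (F P : {set {set T}}).

(** Keeping track of equality shapes the proof. Uniqueness for sets is proved only for compressed
    optimal families, and no compression of sets is ever undone. This suffices because the family of
    traces of a stable extremal family is itself compressed, and because equality forces the stable
    family to contain every [k]-multiset having one of its supports. What must be undone are the
    reflections of multiplicities, and there [r = 0] differs from [r > 0]: undoing a reflection on
    the star of a multiset yields the star of a possibly different multiset, so the canonical forms
    for [r = 0] are not only stars of sets.

    Pushing needs an intersection number above 1. For complements this number is n + t - 2k, and the
    lower bound on n makes it at least 2. For [t = 1] all thresholds equal 2k: the strict window is
    empty unless [r = 0], where a segment of one point needs no pushing, and at the threshold m >=
    2k - 1 leaves only k <= 2, which is treated directly. *)

Definition swap A x y : {set T} := y |: A :\ x.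

Lemma in_swap A x y z : (z \in swap A x y) = (z == y) || (z != x) && (z \in A).
Proof. by rewrite !inE. Qed.

Lemma card_swap A x y : x \in A -> y \notin A -> #|swap A x y| = #|A|.
Proof.
move=> xA yA; rewrite cardsU1 !inE (negbTE yA) andbF /=.
by rewrite (cardsD1 x A) xA.
Qed.

Lemma card_swapI A C x y : x \in A -> y \notin A ->
  #|swap A x y :&: C| + (x \in C) = #|A :&: C| + (y \in C).
Proof.
move=> xA yA.
have nxy : x != y by apply: contraNneq yA => <-.
rewrite (cardsD1 y (_ :&: C)) (cardsD1 x (A :&: C)) !inE eqxx xA /=.
have -> : (swap A x y :&: C) :\ y = (A :&: C) :\ x.
  apply/setP => z; rewrite !inE.
  case: (eqVneq z y) => [->|_] /=; first by rewrite (negbTE yA) andbF.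
  by rewrite andbA.
by mlia.
Qed.

Lemma swapK A x y : x \in A -> y \notin A -> swap (swap A x y) y x = A.
Proof.
move=> xA yA; apply/setP => z; rewrite !inE.
case: (eqVneq z x) => [->|_] /=; first by rewrite xA.
by case: (eqVneq z y) => [->|_] /=; rewrite ?(negbTE yA).
Qed.

(** Invariance under the permutations of [Y], expressed by single exchanges: on a set containing
    exactly one of [x] and [y], an exchange is a transposition. *)
Definition swap_closed Y (P : pred {set T}) :=
  forall A x y, P A -> x \in Y -> y \in Y -> x \in A -> y \notin A ->
    P (swap A x y).

(** Exchanging a point of [A :\: B] for one of [B :\: A] brings [A] one step closer to [B], and both
    points lie in [Y]. Membership thus depends only on the part outside [Y] and on the size. *)
Lemma swap_closed_exchange Y (P : pred {set T}) A B :
  swap_closed Y P -> P A -> A :\: Y = B :\: Y -> #|A| = #|B| -> P B.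
Proof.
move=> PY; elim: {A}_.+1 {-2}A (ltnSn #|A :\: B|) => // n IH A ltn PA eAB cAB.
have cD : #|A :\: B| = #|B :\: A|.
  by have := cardsID B A; have := cardsID A B; rewrite setIC; mlia.
have inY z : (z \in A) != (z \in B) -> z \in Y.
  by move=> nz; apply: contraNT nz => zY; move/setP/(_ z): eAB; rewrite !inE zY /= => ->.
have [/eqP|/set0Pn[x]] := eqVneq (A :\: B) set0.
  move=> A0; have B0 : B :\: A == set0 by rewrite -cards_eq0 -cD cards_eq0.
  suff <- : A = B by [].
  by apply/eqP; rewrite eqEsubset -!finset.setD_eq0 A0.
rewrite inE => /andP[xB xA].
have /set0Pn[y] : B :\: A != set0.
  by rewrite -cards_eq0 -cD cards_eq0; apply/set0Pn; exists x; rewrite inE xB.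
rewrite inE => /andP[yA yB].
have xY : x \in Y by apply: inY; rewrite xA (negbTE xB).
have yY : y \in Y by apply: inY; rewrite yB (negbTE yA).
apply: (IH (swap A x y)); last by rewrite card_swap.
- rewrite -ltnS (leq_trans _ ltn) // ltnS.
  have := card_swapI (~: B) xA yA; rewrite !inE -!setDE yB (negbTE xB) /=; mlia.
- exact: PY.
- rewrite -eAB; apply/setP => z; rewrite !inE.
  case: (eqVneq z x) => [->|_] /=; first by rewrite xY.
  by case: (eqVneq z y) => [->|_] /=; rewrite ?yY.
Qed.

Lemma exists_subset_card A m : m <= #|A| -> exists2 B : {set T}, B \subset A & #|B| = m.
Proof.
move=> mA; have : 0 < #|[set B : {set T} | B \subset A & #|B| == m]|.
  by rewrite cards_draws bin_gt0.
by case/card_gt0P => B; rewrite inE => /andP[? /eqP ?]; exists B.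
Qed.

(* The truncated subtraction makes the bound 0 when A and B fit disjointly. *)
Lemma exists_min_intersection Y A m : m <= #|Y| ->
  exists2 B : {set T}, B \subset Y & #|B| = m /\ #|A :&: B| = #|A :&: Y| + m - #|Y|.
Proof.
move=> mY; have cY := cardsID A Y; rewrite setIC in cY.
case: (leqP m #|Y :\: A|) => [le_m|lt_m].
  have [B /subsetDP[BY dBA] cB] := exists_subset_card le_m.
  exists B => //; split=> //; rewrite setIC.
  move: dBA; rewrite -setI_eq0 => /eqP ->; rewrite cards0; mlia.
have : m - #|Y :\: A| <= #|A :&: Y| by mlia.
case/exists_subset_card => C /subsetIP[CA CY] cC.
exists (C :|: Y :\: A); first by rewrite subUset CY subsetDl.
have dC : C :&: (Y :\: A) = set0.
  by apply/setP => z; rewrite !inE; case: (boolP (z \in C)) => //= /(subsetP CA) ->.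
split; first by rewrite cardsU dC cards0 cC; mlia.
suff -> : A :&: (C :|: Y :\: A) = C by mlia.
apply/setP => z; rewrite !inE; case: (boolP (z \in C)) => /= [/(subsetP CA) -> //|_].
by case: (z \in A).
Qed.

(** This is how invariance is played against [t]-intersection: along with [B], the family contains
    the copy of [B] least favourable to [A], so the bound must survive the smallest overlap that the
    sizes inside [Y] permit. *)
Lemma swap_closed_rearrange Y P A B : swap_closed Y (mem P) -> B \in P ->
  exists B', [/\ B' \in P, B' :\: Y = B :\: Y &
    #|A :&: B'| = #|A :&: Y| + #|B :&: Y| - #|Y| + #|(A :&: B) :\: Y|].
Proof.
move=> PY PB; have [|C CY [cC iC]] := @exists_min_intersection Y A #|B :&: Y|.
  exact: subset_leq_card (subsetIr _ _).
have eC : C :&: Y = C by apply/setIidPl.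
have e1 : (C :|: B :\: Y) :\: Y = B :\: Y.
  apply/setP => z; rewrite !inE; case: (boolP (z \in Y)) => //= zY.
  by rewrite (contraNF (subsetP CY z)).
have e2 : (C :|: B :\: Y) :&: Y = C.
  apply/setP => z; rewrite !inE; case: (boolP (z \in Y)) => //= zY; rewrite ?orbF ?andbT //.
  by rewrite andbF (contraNF (subsetP CY z)).
exists (C :|: B :\: Y); split=> //.
  apply: (swap_closed_exchange PY PB); first by rewrite e1.
  by rewrite -(cardsID Y B) -[in RHS](cardsID Y) e1 e2 cC.
rewrite -iC -(cardsID Y); congr (_ + _); apply: eq_card => z; rewrite !inE.
  case: (boolP (z \in Y)) => zY /=; first by rewrite orbF andbT.
  by rewrite andbF (contraNF (subsetP CY z)) ?andbF.
case: (boolP (z \in Y)) => zY //=.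
by rewrite (contraNF (subsetP CY z)).
Qed.

Lemma swap_closed2_rearrange X Y P A B :
  X :&: Y = set0 -> swap_closed X (mem P) -> swap_closed Y (mem P) -> B \in P ->
  exists2 B', B' \in P & #|A :&: B'| =
    (#|A :&: X| + #|B :&: X| - #|X|) + (#|A :&: Y| + #|B :&: Y| - #|Y|)
      + #|(A :&: B) :\: (X :|: Y)|.
Proof.
move=> dXY PX PY PB.
have [B1 [PB1 eB1 cB1]] := swap_closed_rearrange A PX PB.
have [B2 [PB2 _ cB2]] := swap_closed_rearrange A PY PB1.
have inXY z : z \in Y -> z \notin X.
  by move=> zY; apply/negP => zX; move/setP/(_ z): dXY; rewrite !inE zX zY.
have eYX C : (C :\: X) :&: Y = C :&: Y.
  apply/setP => z; rewrite !inE; case: (boolP (z \in Y)) => [/inXY ->|]; by rewrite ?andbF.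
have eB1Y : B1 :&: Y = B :&: Y by rewrite -eYX eB1 eYX.
exists B2 => //; rewrite cB2 eB1Y.
have c1 := cardsID Y (A :&: B1); have c2 := cardsID Y ((A :&: B) :\: X).
have e1 : A :&: B1 :&: Y = A :&: B :&: Y by rewrite -!setIA eB1Y.
rewrite eYX setDDl in c2; rewrite e1 in c1; mlia.
Qed.

Definition swaps Y e P : {set {set T}} :=
  [set swap A y e | A in P, y in A :&: Y].

(** Count the pairs ([A], [y]) with [y] in [A :&: Y]. The set [swap A y e] keeps [i - 1] points of
    [Y], and closure of [P] makes each of the |Y| - i + 1 missing points a possible [y]. *)
Lemma swaps_double_count Y e P i :
  e \notin Y -> swap_closed Y (mem P) ->
  (forall A, A \in P -> e \notin A /\ #|A :&: Y| = i) ->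
  i * #|P| = (#|Y| - i).+1 * #|swaps Y e P| \/ i = 0.
Proof.
move=> eY PY HP; case: (posnP i) => [->|i_gt0]; [by right|left].
have -> : i * #|P| = \sum_(y in Y) #|[set A in P | y \in A]|.
  rewrite mulnC -sum_nat_const.
  under [RHS]eq_bigr do rewrite -sum1_card.
  rewrite (exchange_big_dep (mem P)) /=; last by move=> y A _; rewrite inE => /andP[].
  apply: eq_bigr => A PA; have [_ <-] := HP _ PA; rewrite -sum1_card.
  by apply: eq_bigl => y; rewrite !inE PA /= andbC.
have sE B : B \in swaps Y e P ->
    e \in B /\ #|B :&: Y| = i.-1.
  case/imset2P => A y PA; rewrite inE => /andP[yA yY] ->.
  have [eA cA] := HP _ PA; split; first by rewrite in_swap eqxx.
  have := card_swapI Y yA eA; rewrite (negbTE eY) yY cA; mlia.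
have -> : (#|Y| - i).+1 * #|swaps Y e P| =
    \sum_(y in Y) #|[set B in swaps Y e P | y \notin B]|.
  rewrite mulnC -sum_nat_const.
  under [RHS]eq_bigr do rewrite -sum1_card.
  rewrite (exchange_big_dep (mem (swaps Y e P))) /=;
    last by move=> y A _; rewrite inE => /andP[].
  apply: eq_bigr => B PB; have [eB cB] := sE _ PB.
  transitivity #|Y :\: B|; last first.
    rewrite -sum1_card; apply: eq_bigl => y.
    by rewrite inE [in RHS]inE PB /= andbC.
  have := cardsID B Y; rewrite setIC cB.
  have : i <= #|Y|.
    case/imset2P: PB => A y PA _ _; have [_ <-] := HP _ PA.
    exact: subset_leq_card (subsetIr _ _).
  mlia.
apply: eq_bigr => y yY.
rewrite -(@card_in_imset _ _ (fun A => swap A y e)); last first.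
  move=> A B; rewrite !inE => /andP[PA yA] /andP[PB yB] eAB.
  have [eA _] := HP _ PA; have [eB _] := HP _ PB.
  by rewrite -(swapK yA eA) eAB swapK.
apply: eq_card => B; apply/imsetP/idP => [[A]|].
  rewrite inE => /andP[PA yA] ->; rewrite inE.
  apply/andP; split; first by apply/imset2P; exists A y => //; rewrite inE yA.
  by rewrite in_swap eqxx orbF; apply: contraNneq eY => <-.
rewrite inE => /andP[/imset2P[A x PA]]; rewrite inE => /andP[xA xY] -> {B} yB.
have [eA cA] := HP _ PA.
have ney : y != e by apply: contraNneq eY => <-.
move: yB; rewrite in_swap negb_or negb_and negbK => /andP[_ /orP[/eqP ->|yA]].
  by exists A => //; rewrite inE PA.
exists (swap A x y).
  by rewrite inE in_swap eqxx andbT; apply: PY.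
apply/setP => z; rewrite !in_swap.
case: (eqVneq z e) => //= nze; case: (eqVneq z y) => [->|//=].
by rewrite (negbTE yA) andbF.
Qed.

Lemma swap_double_count Y e P (Q : {set {set T}}) i : 0 < i <= #|Y| -> e \notin Y ->
  (forall A, A \in P -> e \notin A /\ #|A :&: Y| = i) ->
  (forall B, B \in Q -> e \in B /\ #|B :&: Y| < i) ->
  (forall A y, A \in P -> y \in Y -> y \in A -> swap A y e \in Q) ->
  (forall B y, B \in Q -> y \in Y -> y \notin B -> swap B e y \in P) ->
  i * #|P| = (#|Y| - i).+1 * #|Q|.
Proof.
move=> /andP[i_gt0 iY] eY HP HQ PQ QP.
have neY y : y \in Y -> y != e by apply: contraTneq => ->.
have -> : Q = swaps Y e P.
  apply/setP => B; apply/idP/imset2P => [QB|[A y PA]]; last first.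
    by rewrite inE => /andP[yA yY] ->; apply: PQ.
  have [eB cB] := HQ _ QB.
  have /set0Pn[y] : Y :\: B != set0.
    by rewrite -cards_eq0; have := cardsID B Y; rewrite setIC; mlia.
  rewrite inE => /andP[yB yY]; exists (swap B e y) y; first exact: QP.
    by rewrite inE in_swap eqxx.
  by rewrite swapK.
case: (@swaps_double_count Y e P i) => // [A x y /= PA xY yY xA yA|]; last by lia.
have [eA _] := HP _ PA.
(* An exchange inside [Y] is a push of [x] to [e], into [Q], followed by a pull from [e] to [y],
   back into [P]. *)
have -> : swap A x y = swap (swap A x e) e y.
  apply/setP => z; rewrite !in_swap; case: (eqVneq z y) => //= nzy.
  by case: (eqVneq z e) => [->|//]; rewrite (negbTE eA) andbF.
apply: QP => //; first exact: PQ.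
by rewrite in_swap negb_or neY // negb_and yA orbT.
Qed.
End Swap.

(** * The pushing step *)

Definition set_family (T : finType) k t (F : {set {set T}}) :=
  (forall A, A \in F -> #|A| = k) /\
  (forall A B, A \in F -> B \in F -> t <= #|A :&: B|).

Definition set_optimal (T : finType) k t (F : {set {set T}}) :=
  set_family k t F /\ forall F' : {set {set T}}, set_family k t F' -> #|F'| <= #|F|.

Section Pushing.
Variables (T : finType) (k t : nat) (F : {set {set T}}) (Y : {set T}) (e : T).
Implicit Types (A B C : {set T}) (x y z : T) (P R : {set {set T}}).
Hypotheses (optF : set_optimal k t F) (eY : e \notin Y).
Hypothesis (FY : swap_closed Y (mem F)).
Hypothesis (FZe : forall A z, A \in F -> z \notin Y -> z \in A -> e \notin A ->
  swap A z e \in F).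

(** The obstruction to extending the invariance from [Y] to [e |: Y]. A single failing [y] is asked
    for; invariance under [Y] then makes every [y] fail ([blocked_all]). *)
Definition blocked :=
  [set A in F | (e \notin A) && [exists y in A :&: Y, swap A y e \notin F]].
Definition blocked_level i := [set A in blocked | #|A :&: Y| == i].

Lemma pushing_card A : A \in F -> #|A| = k.
Proof. by case: optF => -[cF _] _; apply: cF. Qed.
Lemma pushing_int A B : A \in F -> B \in F -> t <= #|A :&: B|.
Proof. by case: optF => -[_ iF] _; apply: iF. Qed.
Lemma pushing_max (F' : {set {set T}}) : set_family k t F' -> #|F'| <= #|F|.
Proof. by case: optF => _; apply. Qed.

Lemma blockedW A : A \in blocked -> A \in F. Proof. by rewrite inE => /andP[]. Qed.
Lemma blocked_notin A : A \in blocked -> e \notin A. Proof. by rewrite inE => /and3P[]. Qed.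

Lemma pushing_neq y : y \in Y -> y != e. Proof. by apply: contraTneq => ->. Qed.

Lemma pushing_swap_swap A x y : x \in Y -> y \in Y -> x \in A -> y \notin A -> e \notin A ->
  swap (swap A x y) y e = swap A x e.
Proof.
move=> xY yY xA yA eA; apply/setP => z; rewrite !in_swap.
case: (eqVneq z e) => //= nze; case: (eqVneq z y) => [->|//=].
by rewrite (negbTE yA) andbF.
Qed.

Lemma blocked_all A y : A \in blocked -> y \in A -> y \in Y -> swap A y e \notin F.
Proof.
rewrite inE => /and3P[FA eA /existsP[x /andP[]]]; rewrite inE => /andP[xA xY] nF yA yY.
apply: contra nF => FAy.
case: (eqVneq x y) => [->//|nxy].
have -> : swap A x e = swap (swap A y e) x y.
  apply/setP => z; rewrite !in_swap.
  case: (eqVneq z y) => [->|nzy] /=; first by rewrite [y == x]eq_sym nxy yA orbT.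
  by case: (eqVneq z x) => [->|_] //=; rewrite orbF (negbTE (pushing_neq xY)).
apply: FY => //; rewrite in_swap.
  by rewrite nxy xA orbT.
by rewrite eqxx /= orbF pushing_neq.
Qed.

Lemma blocked_closed : swap_closed Y (mem blocked).
Proof.
move=> A x y /= LA xY yY xA yA; have FA := blockedW LA; have eA := blocked_notin LA.
rewrite inE; apply/and3P; split; first exact: FY.
  by rewrite in_swap negb_or negb_and eA orbT andbT eq_sym pushing_neq.
apply/existsP; exists y; rewrite inE in_swap eqxx yY /=.
by rewrite pushing_swap_swap // blocked_all.
Qed.

(** The tight case: [A] and [B] are disjoint outside [Y], and the least overlap that their sizes
    allow inside [Y] is exactly [t], so that losing one common point may be fatal. *)
Definition pushing_conflict A B :=
  (#|A :&: Y| + #|B :&: Y| == #|Y| + t) && ((A :&: B) :\: Y == set0).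

(** The only danger is [y] in [B] and [e] not in [B]. Then [swap B y e] belongs to [F] and misses
    [y], so [A] and [B] share [t] points besides [y]. *)
Lemma push_outside A B y :
  A \in blocked -> B \in F -> B \notin blocked -> y \in A -> y \in Y ->
  t <= #|swap A y e :&: B|.
Proof.
move=> LA FB nLB yA yY; have FA := blockedW LA; have eA := blocked_notin LA.
have := card_swapI B yA eA; have := pushing_int FA FB.
case: (boolP (e \in B)) => eB /=; first by case: (y \in B); mlia.
case: (boolP (y \in B)) => yB /=; last mlia.
have FB' : swap B y e \in F.
  move: nLB; rewrite inE FB eB /= => /existsPn/(_ y).
  by rewrite inE yB yY /= negbK.
have := pushing_int FB' FA.
have := card_swapI A yB eB; rewrite yA (negbTE eA) /= [B :&: A]setIC; mlia.
Qed.

(* Rearrange B inside Y so that it meets A there as little as possible.  If A and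
   B also met in some z outside Y, then pushing z to e in A would violate
   t-intersection: so a pair that fails after pushing y is in conflict. *)
Lemma push_L A B y : A \in blocked -> B \in blocked -> y \in A -> y \in Y ->
  ~~ pushing_conflict A B -> t <= #|swap A y e :&: B|.
Proof.
move=> LA LB yA yY; apply: contraR; rewrite -ltnNge => small.
have FA := blockedW LA; have eA := blocked_notin LA.
have FB := blockedW LB; have eB := blocked_notin LB.
have cI := card_swapI B yA eA; rewrite (negbTE eB) addn0 in cI.
have iAB := pushing_int FA FB.
have yB : y \in B by case: (y \in B) cI => //; mlia.
have [B' [FB' eB' cB']] := swap_closed_rearrange A FY FB.
have iAB' := pushing_int FA FB'.
have lo : #|A :&: Y| + #|B :&: Y| <= #|(A :&: B) :&: Y| + #|Y|.
  have -> : A :&: B :&: Y = (A :&: Y) :&: (B :&: Y) by rewrite setIACA setIid.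
  have := cardsUI (A :&: Y) (B :&: Y).
  have : #|A :&: Y :|: B :&: Y| <= #|Y| by rewrite subset_leq_card // subUset !subsetIr.
  mlia.
have := cardsID Y (A :&: B) => cID.
have pos : 0 < #|A :&: B :&: Y| by apply/card_gt0P; exists y; rewrite !inE yA yB.
rewrite yB in cI.
suff c0 : #|(A :&: B) :\: Y| = 0.
  by rewrite /pushing_conflict -cards_eq0 c0 eqxx andbT; mlia.
apply/eqP; rewrite cards_eq0; apply: contraT => /set0Pn[z].
rewrite !inE => /and3P[zY zA zB].
have zB' : z \in B'.
  by move/setP/(_ z): eB'; rewrite !inE zY zB.
have eB'' : e \notin B'.
  by move/setP/(_ e): eB'; rewrite !inE eY (negbTE eB) /= => ->.
have := pushing_int (FZe FA zY zA eA) FB'.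
have := card_swapI B' zA eA; rewrite zB' (negbTE eB'') /=.
mlia.
Qed.

(** The common point [e] makes up for the possible loss of [x]. *)
Lemma push_both A B y x : A \in blocked -> B \in blocked ->
  y \in A -> y \in Y -> x \in B -> x \in Y ->
  ~~ pushing_conflict A B -> t <= #|swap A y e :&: swap B x e|.
Proof.
move=> LA LB yA yY xB xY nc.
have := push_L LA LB yA yY nc.
have eB := blocked_notin LB; rewrite [swap A y e :&: B]setIC [swap A y e :&: swap B x e]setIC.
have := card_swapI (swap A y e) xB eB.
by rewrite (in_swap A y e e) eqxx /=; case: (_ \in _); mlia.
Qed.

Lemma card_blocked_swap A y : A \in blocked -> y \in A -> #|swap A y e| = k.
Proof. by move=> LA yA; rewrite card_swap ?(pushing_card (blockedW LA)) ?blocked_notin. Qed.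

(** Optimality as a trade: removing [R] and adding the pushed sets leaves an admissible family, and
    the pushed sets are new because their origins are blocked. *)
Lemma push_replace P R : P \subset blocked -> R \subset F ->
  (forall A B, A \in P -> B \in blocked -> B \notin R -> ~~ pushing_conflict A B) ->
  (forall A B, A \in P -> B \in P -> ~~ pushing_conflict A B) ->
  #|swaps Y e P| <= #|R|.
Proof.
move=> /subsetP PL RF nPR nPP.
have sP B : B \in swaps Y e P -> exists A y, [/\ A \in P, y \in A, y \in Y & B = swap A y e].
  by case/imset2P => A y PA; rewrite inE => /andP[? ?] ->; exists A, y.
have /pushing_max : set_family k t ((F :\: R) :|: swaps Y e P).
  split=> [A|A B].
    rewrite inE => /orP[|/sP[B [y [PB yB yY ->]]]]; last by rewrite card_blocked_swap ?PL.
    by rewrite inE => /andP[_ /pushing_card].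
  have mix A' B' : A' \in swaps Y e P -> B' \in F :\: R -> t <= #|A' :&: B'|.
    move=> /sP[C [y [PC yC yY ->]]]; rewrite inE => /andP[nR FB].
    case: (boolP (B' \in blocked)) => LB; last exact: (push_outside (PL _ PC)).
    by apply: push_L => //; [exact: PL|exact: nPR].
  rewrite !inE -!in_setD => /orP[FA|sA] /orP[FB|sB].
  - by apply: pushing_int; [move: FA|move: FB]; rewrite inE => /andP[].
  - by rewrite setIC mix.
  - exact: mix.
  - have [A' [y [PA yA yY ->]]] := sP _ sA; have [B' [x [PB xB xY ->]]] := sP _ sB.
    by apply: push_both => //; [exact: PL|exact: PL|exact: nPP].
rewrite cardsU.
have -> : (F :\: R) :&: swaps Y e P = set0.
  apply/setP => B; rewrite !inE; apply/negP => /andP[/andP[_ FB] /sP[A [y [PA yA yY eB]]]].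
  by move: (blocked_all (PL _ PA) yA yY); rewrite -eB FB.
rewrite cards0 subn0.
have := cardsID R F; have -> : F :&: R = R by apply/setIidPr.
mlia.
Qed.

Lemma blocked_level_mem_closed i z : z \notin Y ->
  swap_closed Y (mem [set A in blocked_level i | z \in A]).
Proof.
move=> zY A x y /=; rewrite [_ \in [set _ in _ | _]]inE [A \in blocked_level i]inE.
move=> /andP[/andP[LA /eqP cA] zA] xY yY xA yA.
rewrite inE in_swap zA andbT; apply/andP; split; last first.
  by rewrite orbC; case: eqP zY => // ->; rewrite xY.
rewrite inE; apply/andP; split; first exact: blocked_closed.
by have := card_swapI Y xA yA; rewrite xY yY cA => /addIn ->.
Qed.

Lemma blocked_level_closed i : swap_closed Y (mem (blocked_level i)).
Proof.
move=> A x y /=; rewrite inE => /andP[LA /eqP cA] xY yY xA yA.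
rewrite inE; apply/andP; split; first exact: blocked_closed.
by have := card_swapI Y xA yA; rewrite xY yY cA => /addIn ->.
Qed.

(* Let A be blocked and i = |A :&: Y|.  The pushed sets of level i conflict only
   with level j = |Y| + t - i.  If i <> j, trading level j for the pushed level i,
   or level i for the pushed level j, cannot enlarge F; counting by level, the
   two inequalities give i j <= (i - t + 1) (j - t + 1), absurd for t > 1.  If
   i = j, push only the members of level i through a given z outside Y, which
   are conflict-free, and drop the others: summed over z, the resulting
   inequalities contradict [arith]. *)
Lemma pushing (ht : 1 < t)
  (arith : forall i, i <= #|Y| -> 2 * i = #|Y| + t ->
     (#|Y| - i).+1 * (#|T| - #|Y|.+1) < (k - i) * #|Y|.+1) A y :
  A \in F -> y \in Y -> y \in A -> e \notin A -> swap A y e \in F.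
Proof.
move=> FA yY yA eA; apply: contraT => nF.
have LA : A \in blocked.
  by rewrite inE FA eA; apply/existsP; exists y; rewrite inE yA yY.
pose i := #|A :&: Y|.
have LiA : A \in blocked_level i by rewrite inE LA /=.
have i_gt0 : 0 < i by apply/card_gt0P; exists y; rewrite inE yA.
have le_iY : i <= #|Y| by apply: subset_leq_card (subsetIr _ _).
have L_e i' B : B \in blocked_level i' -> [/\ B \in blocked, e \notin B & #|B :&: Y| = i'].
  by rewrite inE => /andP[LB /eqP <-]; split=> //; apply: blocked_notin.
have dc i' :
    i' * #|blocked_level i'| = (#|Y| - i').+1 * #|swaps Y e (blocked_level i')| \/ i' = 0.
  by apply: swaps_double_count => //; [exact: blocked_level_closed|move=> B /L_e[]].
have Li_gt0 : 0 < #|blocked_level i| by apply/card_gt0P; exists A.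
have [eij|nij] := eqVneq (2 * i) (#|Y| + t).
  have Hz z : z \in ~: (e |: Y) ->
      #|Y|.+1 * #|[set B in blocked_level i | z \in B]| <= (#|Y| - i).+1 * #|blocked_level i|.
    rewrite !inE negb_or => /andP[nze zY].
    set P := [set B in blocked_level i | z \in B].
    have PL : P \subset blocked by apply/subsetP => B; rewrite inE => /andP[/L_e[]].
    have dz : i * #|P| = (#|Y| - i).+1 * #|swaps Y e P| \/ i = 0.
      apply: swaps_double_count => //; first exact: blocked_level_mem_closed.
      by move=> B; rewrite inE => /andP[/L_e[]].
    have Pz B : B \in P -> z \in B by rewrite inE => /andP[].
    have cD := cardsID P (blocked_level i).
    have eI : blocked_level i :&: P = P by apply/setIidPr/subsetP => B; rewrite inE => /andP[].
    rewrite eI in cD.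
    have nc B C : B \in P -> C \in P -> ~~ pushing_conflict B C.
      move=> /Pz zB /Pz zC; rewrite negb_and; apply/orP; right.
      by apply/set0Pn; exists z; rewrite !inE zY zB.
    have le_swaps : #|swaps Y e P| <= #|blocked_level i :\: P|.
     apply: push_replace => //.
    - by apply/subsetP => B; rewrite in_setD => /andP[_ /L_e[/blockedW]].
    - move=> B C PB LC nC; case: (boolP (C \in P)) => [|nPC]; first exact: nc.
      rewrite negb_and; apply/orP; left.
      have /L_e[_ _ ->] : B \in blocked_level i by move: PB; rewrite inE => /andP[].
      apply: contraNneq nC => eBC; rewrite in_setD nPC inE LC /=.
      by apply/eqP; mlia.
    case: dz => [dz|]; last mlia.
    (* With L the level, this reads i |P| <= (|Y| - i + 1)(|L| - |P|); collecting |P| gives the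
       coefficient |Y| + 1. *)
    have := leq_mul (leqnn (#|Y| - i).+1) le_swaps; rewrite -dz -cD mulnDr.
    have -> : #|Y|.+1 = (#|Y| - i).+1 + i by mlia.
    rewrite mulnDl; move: ((#|Y| - i).+1 * _) ((#|Y| - i).+1 * _) (i * _); mlia.
  have : \sum_(z in ~: (e |: Y)) #|Y|.+1 * #|[set B in blocked_level i | z \in B]|
      <= \sum_(z in ~: (e |: Y)) (#|Y| - i).+1 * #|blocked_level i| by apply: leq_sum.
  rewrite sum_nat_const -big_distrr /= [#|~: _|]cardsCs setCK cardsU1 eY add1n.
  (* Each member of the level has [k - i] points outside [Y], none of them [e]. *)
  have -> : \sum_(z in ~: (e |: Y)) #|[set B in blocked_level i | z \in B]| =
      #|blocked_level i| * (k - i).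
    under eq_bigr do rewrite -sum1_card.
    rewrite (exchange_big_dep (mem (blocked_level i))) /=;
      last by move=> z B _; rewrite inE => /andP[].
    rewrite -sum_nat_const; apply: eq_bigr => B /[dup] LB /L_e[LB' eB cB].
    rewrite -(pushing_card (blockedW LB')) -(cardsID Y B) cB addKn -sum1_card.
    apply: eq_bigl => z; rewrite in_setC in_setU1 in_setD in_set LB /= negb_or -andbA.
    by case: (eqVneq z e) => [->|]; rewrite ?(negbTE eB) ?andbF.
  have := arith i le_iY eij; move: (#|T| - _) Li_gt0 => N L_gt0.
  rewrite -(ltn_pmul2r L_gt0) => lt le.
  have : #|Y|.+1 * (#|blocked_level i| * (k - i)) < (k - i) * #|Y|.+1 * #|blocked_level i|.
    by apply: leq_ltn_trans le _; rewrite mulnCA mulnA.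
  by rewrite [#|blocked_level i| * _]mulnC mulnCA mulnA ltnn.
pose j := #|Y| + t - i.
have main i' j' : i' + j' = #|Y| + t -> i' != j' ->
    #|swaps Y e (blocked_level i')| <= #|blocked_level j'|.
  move=> sij nij'; apply: push_replace.
  - by apply/subsetP => B /L_e[].
  - by apply/subsetP => B /L_e[/blockedW].
  - move=> B C /L_e[_ _ cB] LC nC; rewrite negb_and cB; apply/orP; left.
    apply: contraNneq nC => cC; rewrite inE LC /=; apply/eqP; mlia.
  - move=> B C /L_e[_ _ cB] /L_e[_ _ cC]; rewrite negb_and cB cC; apply/orP; left.
    apply: contraNneq nij'; mlia.
have sij : i + j = #|Y| + t by rewrite /j; mlia.
have neq_ij : i != j by apply: contraNneq nij => eij; apply/eqP; mlia.
have m1 := main i j sij neq_ij.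
have m2 : #|swaps Y e (blocked_level j)| <= #|blocked_level i|.
  by apply: main; [mlia|rewrite eq_sym].
have sLi : swap A y e \in swaps Y e (blocked_level i).
  by apply/imset2P; exists A y; rewrite // inE yA.
have sLi_gt0 : 0 < #|swaps Y e (blocked_level i)| by apply/card_gt0P; exists (swap A y e).
have Lj_gt0 : 0 < #|blocked_level j| by mlia.
have [B LB] := card_gt0P Lj_gt0.
have le_jY : j <= #|Y|.
  have [_ _ <-] := L_e _ _ LB; exact: subset_leq_card (subsetIr _ _).
case: (dc i) => [d1|]; last mlia.
case: (dc j) => [d2|]; last mlia.
(* The contradiction is a cycle: with L_i, L_j the sizes of the levels, i L_i <= (j - t + 1) L_j < j
   L_j <= (i - t + 1) L_i < i L_i, where [t > 1] gives the strict steps. *)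
have e1 : (#|Y| - i).+1 = (j - t).+1 by mlia.
have e2 : (#|Y| - j).+1 = (i - t).+1 by mlia.
rewrite e1 in d1; rewrite e2 in d2.
have b1 : (j - t).+1 < j by mlia.
have b2 : (i - t).+1 < i by mlia.
have c1 : i * #|blocked_level i| <= (j - t).+1 * #|blocked_level j|.
  by rewrite d1 leq_mul2l m1 orbT.
have c2 : j * #|blocked_level j| <= (i - t).+1 * #|blocked_level i|.
  by rewrite d2 leq_mul2l m2 orbT.
have c3 : (j - t).+1 * #|blocked_level j| < j * #|blocked_level j|.
  by rewrite ltn_mul2r Lj_gt0 b1.
have c4 : (i - t).+1 * #|blocked_level i| < i * #|blocked_level i|.
  by rewrite ltn_mul2r Li_gt0 b2.
mlia.
Qed.
End Pushing.

(** * Exchanges as transpositions, and under complementation *)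

Section SwapClosure.
Variable T : finType.
Implicit Types (A : {set T}) (x y : T).

Lemma tperm_imset_swap (A : {set T}) i j :
  j \in A -> i \notin A -> tperm i j @: A = swap A j i.
Proof.
move=> jA iA; apply/setP => z; rewrite in_swap -{1}[z](tpermK i j).
rewrite mem_imset; last exact: perm_inj.
case: tpermP => [->|->|/eqP ni /eqP nj]; first by rewrite jA eqxx.
  by rewrite eqxx (negbTE iA) orbF; apply/esym/negbTE; apply: contraTneq jA => ->.
by rewrite (negbTE ni) nj.
Qed.

Lemma swap_closedU1 (Y : {set T}) e (P : pred {set T}) :
  swap_closed Y P ->
  (forall A y, P A -> y \in Y -> e \in A -> y \notin A -> P (swap A e y)) ->
  (forall A y, P A -> y \in Y -> y \in A -> e \notin A -> P (swap A y e)) ->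
  swap_closed (e |: Y) P.
Proof.
move=> PY Pe eP A x y PA.
rewrite !inE => /orP[/eqP ->|xY] /orP[/eqP ->|yY] xA yA.
- by rewrite xA in yA.
- exact: Pe.
- exact: eP.
- exact: PY.
Qed.

Lemma swapC (A : {set T}) x y : x \notin A -> y \in A ->
  swap (~: A) x y = ~: swap A y x.
Proof.
move=> xA yA; apply/setP => z; rewrite in_swap in_setC in_setC in_swap.
case: (eqVneq z y) => [->|_]; first by rewrite orbF; apply/esym/eqP => e; rewrite -e yA in xA.
by case: (eqVneq z x) => //=.
Qed.

Lemma swap_closedC (Y : {set T}) (F : {set {set T}}) :
  swap_closed Y (mem F) -> swap_closed Y (mem (@setC _ @: F)).
Proof.
move=> FY A x y /= /imsetP[B FB ->] xY yY; rewrite !inE negbK => xB yB.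
by rewrite swapC // mem_imset; [apply: FY|exact: setC_inj].
Qed.
End SwapClosure.

(** * Two-point shifts *)

Section Shift.
Variables (T : finType) (I : T -> T -> nat) (U : {set T}).
Implicit Types (A B : T) (F : {set T}).

(** An abstract two-point reflection from a far half to a near half, covering both the
    transpositions of sets and the reflections of multiplicities. Invariance of [I] is asked only
    between far points: the reflection with s = 1 is the identity where it would make a multiplicity
    negative, so it does not preserve [I] everywhere. *)
Definition polarization (far : pred T) (rho : T -> T) :=
  [/\ forall A, A \in U -> rho A \in U /\ rho (rho A) = A,
      forall A, A \in U -> far A -> ~~ far (rho A),
      forall A B, A \in U -> B \in U -> far A -> far B ->
        I (rho A) (rho B) = I A B /\ I (rho A) B = I A (rho B)
    & forall A B, A \in U -> B \in U -> far A -> ~~ far B ->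
        I A B <= I (rho A) B].

Definition int_family t F :=
  F \subset U /\ forall A B, A \in F -> B \in F -> t <= I A B.

Definition shift_elt (far : pred T) (rho : T -> T) F A :=
  if far A && (rho A \notin F) then rho A else A.

Definition shift far rho F := shift_elt far rho F @: F.

Lemma shift_elt_inj far rho F : polarization far rho -> F \subset U ->
  {in F &, injective (shift_elt far rho F)}.
Proof.
case=> rhoU _ _ _ /subsetP FU A B FA FB; rewrite /shift_elt.
have [_ rA] := rhoU _ (FU _ FA); have [_ rB] := rhoU _ (FU _ FB).
case: ifP => [/andP[_ nA]|_]; case: ifP => [/andP[_ nB]|_] // e.
- by rewrite -rA e rB.
- by rewrite e FB in nA.
- by rewrite -e FA in nB.
Qed.

Lemma card_shift far rho F : polarization far rho -> F \subset U ->
  #|shift far rho F| = #|F|.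
Proof. by move=> pol FU; rewrite card_in_imset //; apply: shift_elt_inj. Qed.

(** The critical pair is a moved [A] and an unmoved [B]. If [B] is not far, reflecting [A] can only
    increase [I]; if [B] is far, it stayed because [rho B] is in [F], and I (rho A) B = I A (rho
    B). *)
Lemma shift_family far rho t F : commutative I -> polarization far rho ->
  int_family t F -> int_family t (shift far rho F).
Proof.
move=> Isym [rhoU fr iso mono] [/subsetP FU iF]; split.
  apply/subsetP => _ /imsetP[A FA ->]; rewrite /shift_elt.
  by case: ifP => _; [case: (rhoU _ (FU _ FA))|apply: FU].
have mix A B : A \in F -> B \in F -> far A -> ~~ (far B && (rho B \notin F)) ->
    t <= I (rho A) B.
  move=> FA FB fA; rewrite negb_and negbK; case: (boolP (far B)) => [fB /= rB|nB _].
    by have [_ ->] := iso _ _ (FU _ FA) (FU _ FB) fA fB; apply: iF.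
  by apply: leq_trans (mono _ _ (FU _ FA) (FU _ FB) fA nB); apply: iF.
move=> _ _ /imsetP[A FA ->] /imsetP[B FB ->]; rewrite /shift_elt.
case: ifP => [/andP[fA _]|/negbT nA]; case: ifP => [/andP[fB _]|/negbT nB].
- by have [-> _] := iso _ _ (FU _ FA) (FU _ FB) fA fB; apply: iF.
- exact: mix.
- by rewrite Isym mix.
- exact: iF.
Qed.

Lemma in_shift far rho F A : polarization far rho -> F \subset U -> A \in U ->
  (A \in shift far rho F) =
  if far A then (A \in F) && (rho A \in F)
  else (A \in F) || far (rho A) && (rho A \in F).
Proof.
move=> [rhoU fr _ _] /subsetP FU UA; have [UrA rrA] := rhoU _ UA.
apply/imsetP/idP => [[B FB ->]|].
  have [_ rB] := rhoU _ (FU _ FB); rewrite /shift_elt.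
  case: (boolP (far B && (rho B \notin F))) => [/andP[fB nB]|].
    by rewrite (negbTE (fr _ (FU _ FB) fB)) rB fB FB orbT.
  by rewrite negb_and negbK; case: (far B) => //= [->|]; rewrite FB.
case: ifP => [fA /andP[FA rA]|nA].
  by exists A => //; rewrite /shift_elt fA rA.
case: (boolP (A \in F)) => [FA _|nFA /= /andP[fr' FrA]].
  by exists A; rewrite // /shift_elt nA.
by exists (rho A); rewrite // /shift_elt fr' rrA nFA.
Qed.

(* Every shift that moves something lowers the total weight, so a property of
   families can be pulled back from the stable ones. *)
Lemma shift_ind (O : finType) (far : O -> pred T) (rho : O -> T -> T)
    (w : T -> nat) t (P : {set T} -> Prop) :
  commutative I -> (forall o, polarization (far o) (rho o)) ->
  (forall o A, A \in U -> far o A -> w (rho o A) < w A) ->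
  (forall F, int_family t F ->
     (forall o A, A \in F -> far o A -> rho o A \in F) -> P F) ->
  (forall F o A, int_family t F -> A \in F -> far o A -> rho o A \notin F ->
     P (shift (far o) (rho o) F) -> P F) ->
  forall F, int_family t F -> P F.
Proof.
move=> Isym pol wrho Pstable Pshift F.
elim: {F}_.+1 {-2}F (ltnSn (\sum_(A in F) w A)) => // n IH F ltn famF.
case: (boolP [exists o, exists A in F, far o A && (rho o A \notin F)]).
  case/existsP => o /existsP[A /and3P[FA fA nA]].
  apply: (Pshift F o A) => //; apply: IH; last exact: shift_family.
  rewrite -ltnS (leq_trans _ ltn) // ltnS big_imset /=; last first.
    by apply: shift_elt_inj => //; case: famF.
  have [/subsetP FU _] := famF.
  rewrite (bigD1 A) //= [X in _ < X](bigD1 A) //= -addSn leq_add //.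
    by rewrite /shift_elt fA nA wrho // FU.
  apply: leq_sum => B /andP[FB _]; rewrite /shift_elt; case: ifP => // /andP[fB _].
  by rewrite ltnW // wrho // FU.
move=> /existsPn nex; apply: Pstable => // o A FA fA.
have /existsPn/(_ A) := nex o; rewrite FA fA /=; by rewrite negbK.
Qed.
End Shift.

(** * Compressed families of sets *)

Section Compression.
Variables (n k t : nat).
Implicit Types (A B : {set 'I_n}) (F : {set {set 'I_n}}).

Definition compressed F := forall A (i j : 'I_n),
  A \in F -> i < j -> j \in A -> i \notin A -> swap A j i \in F.

Lemma exists_compressed F : set_family k t F ->
  exists F', [/\ set_family k t F', compressed F' & #|F'| = #|F|].
Proof.
pose U := [set A : {set 'I_n} | #|A| == k].
pose I A B := #|A :&: B|.
pose far (o : 'I_n * 'I_n) (A : {set 'I_n}) := [&& o.1 < o.2, o.2 \in A & o.1 \notin A].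
pose rho (o : 'I_n * 'I_n) (A : {set 'I_n}) : {set 'I_n} := tperm o.1 o.2 @: A.
have rI o A B : #|rho o A :&: rho o B| = #|A :&: B|.
  rewrite -imsetI ?card_imset //; first exact: perm_inj.
  by move=> x y _ _; apply: perm_inj.
have rK o A : rho o (rho o A) = A.
  by rewrite /rho -imset_comp (eq_imset _ (tpermK _ _)) imset_id.
have far_swap o A : far o A -> rho o A = swap A o.2 o.1.
  by case/and3P => _ ? ?; apply: tperm_imset_swap.
have Isym : commutative I by move=> A B; rewrite /I setIC.
have pol o : polarization I U (far o) (rho o).
  split=> [A|A _ fA|A B _ _ _ _|A B _ _ fA].
  - by rewrite !inE card_imset //; exact: perm_inj.
  - rewrite far_swap //.
    by apply/negP => /and3P[_ _]; rewrite in_swap eqxx.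
  - by rewrite /I rI; split=> //; rewrite -[RHS](rI o) rK.
  - rewrite /I far_swap //; case/and3P: fA => lt o2 o1; rewrite /far /= lt /=.
    have := card_swapI B o2 o1; do 2!case: (_ \in B) => //=; mlia.
have fE G : int_family I U t G <-> set_family k t G.
  split=> -[G1 G2]; split=> //.
    by move=> A /(subsetP G1); rewrite inE => /eqP.
  by apply/subsetP => A /G1; rewrite inE => ->.
move/fE; move: F.
apply: (@shift_ind _ I U _ far rho (fun A => \sum_(x in A) x)) => //.
- move=> o A _ fA; rewrite far_swap //; case/and3P: fA => lt o2 o1.
  rewrite big_setU1 ?inE ?(negbTE o1) ?andbF //= [X in _ < X](big_setD1 o.2) //=.
  by rewrite ltn_add2r.
- move=> F /fE fF st; exists F; split=> // A i j FA ij jA iA.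
  have fA : far (i, j) A by rewrite /far /= ij jA.
  by have := st _ _ FA fA; rewrite far_swap.
- move=> F o A [FU _] _ _ _ [F' [f1 f2 f3]].
  by exists F'; split=> //; rewrite f3 (card_shift (pol o)).
Qed.

Lemma exists_optimal : exists2 F, set_optimal k t F & compressed F.
Proof.
pose famb F := [forall A in F, (#|A| == k) && [forall B in F, t <= #|A :&: B|]].
have fP F : reflect (set_family k t F) (famb F).
  apply: (iffP forall_inP) => [H|[H1 H2] A FA].
    split=> [A /H /andP[/eqP]//|A B FA FB].
    by have /andP[_ /forall_inP] := H _ FA; apply.
  by rewrite H1 // eqxx /=; apply/forall_inP => B; apply: H2.
have f0 : famb set0 by apply/forall_inP => A; rewrite inE.
case: (arg_maxnP (fun F => #|F|) f0) => F /fP fF maxF.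
have [F' [fF' cF' eF']] := exists_compressed fF.
by exists F' => //; split=> // F'' /fP/maxF; rewrite eF'.
Qed.

(** Passing to complements adds n - 2k to every intersection; 2k <= n + t keeps the natural-number
    subtraction n + t - 2k from truncating. *)
Lemma set_optimal_setC F : k <= n -> 2 * k <= n + t ->
  set_optimal k t F ->
  set_optimal (n - k) (n + t - 2 * k) (@setC _ @: F).
Proof.
move=> kn ktn [[cF iF] maxF].
have cC A : #|~: A| = n - #|A| by have := cardsC A; rewrite card_ord; mlia.
have cI A B : #|~: A :&: ~: B| + #|A| + #|B| = n + #|A :&: B|.
  have le_n : #|A :|: B| <= n by rewrite -[X in _ <= X]card_ord max_card.
  by rewrite -setCU cC; have := cardsUI A B; mlia.
split.
  split=> [_ /imsetP[A FA ->]|_ _ /imsetP[A FA ->] /imsetP[B FB ->]].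
    by rewrite cC cF.
  by have := cI A B; rewrite (cF A) ?(cF B) //; have := iF _ _ FA FB; mlia.
move=> F' [cF' iF'].
rewrite [X in _ <= X]card_imset; last exact: setC_inj.
rewrite -(card_imset (mem F') (@setC_inj _)).
apply: maxF; split=> [_ /imsetP[A FA ->]|_ _ /imsetP[A FA ->] /imsetP[B FB ->]].
  by rewrite cC cF' //; mlia.
have := cI A B; rewrite (cF' A) ?(cF' B) //; have := iF' _ _ FA FB; mlia.
Qed.

Definition segment l : {set 'I_n} := [set x : 'I_n | x < l].

Lemma card_segment l : l <= n -> #|segment l| = l.
Proof.
move=> ln; rewrite -[RHS]card_ord -(@card_imset _ _ (widen_ord ln)); last first.
  by move=> x y /(congr1 val) /= /val_inj.
apply: eq_card => x; rewrite inE; apply/idP/imsetP => [xl|[y _ ->]]; last by rewrite /= ltn_ord.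
by exists (Ordinal xl) => //; apply: val_inj.
Qed.
End Compression.

(** * The Ahlswede-Khachatrian theorem for compressed families *)

Section CompleteIntersection.
Variables (n k t : nat).
Implicit Types (A B : {set 'I_n}) (F : {set {set 'I_n}}).

Lemma swap_closed_segment F u r : set_optimal k t F -> compressed F ->
  u = t + 2 * r -> u <= n -> r <= k - t -> t <= k ->
  1 < t \/ t = 1 /\ r = 0 ->
  (0 < r -> r * n < (k - t + 1) * (t + 2 * r - 1)) ->
  swap_closed (segment n u) (mem F).
Proof.
move=> optF cF uE un rkt tk t_cases upper.
(* For [t = 1] and [r = 0] the segment has at most one point, and there is nothing to exchange. *)
case: t_cases => [ht|[t1 r0]]; last first.
  move=> A x y _; rewrite !inE => xu yu xA yA.
  have exy : x = y by apply: val_inj => /=; lia.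
  by rewrite -exy xA in yA.
suff H l : l <= u -> swap_closed (segment n l) (mem F) by apply: H.
elim: l => [|l IH] lu; first by move=> A x y _; rewrite inE.
have ln : l < n by lia.
pose e := Ordinal ln.
have eY : e \notin segment n l by rewrite inE /= ltnn.
have -> : segment n l.+1 = e |: segment n l.
  by apply/setP => x; rewrite !inE ltnS leq_eqVlt -val_eqE.
have Yl := IH (ltnW lu).
apply: swap_closedU1 => // A y FA yY.
  by move=> eA yA; apply: cF => //; move: yY; rewrite inE.
move=> yA eA; apply: (pushing optF eY) => //.
  move=> B z FB; rewrite inE -leqNgt => lz zB eB; apply: cF => //=.
  rewrite ltn_neqAle lz andbT; apply: contraNneq eB => elz.
  by have -> : e = z by apply: val_inj.
rewrite card_segment ?(ltnW ln) // card_ord => i il ei.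
have up := upper.
clear - uE lu il ei rkt tk ht ln up.
have [s sE] : exists s, i = t + s by exists (i - t); lia.
have lE : l = t + 2 * s by lia.
have sr : s.+1 <= r by lia.
have {}up := up (leq_trans (ltn0Sn s) sr).
have -> : (l - i).+1 = s.+1 by lia.
have -> : k - i = k - t - s by lia.
(* This says n < [threshold k t s.+1]. The arithmetic condition of [pushing] reduces to it, and it
   follows from the bound at [r] because thresholds do not increase with the index and s + 1 <=
   r. *)
have key : s.+1 * n < (k - t + 1) * (t + 2 * s + 1).
  rewrite -(ltn_pmul2l (leq_trans (ltn0Sn s) sr)).
  have h1 : s.+1 * (r * n) < s.+1 * ((k - t + 1) * (t + 2 * r - 1)) by rewrite ltn_pmul2l.
  have h2 : s.+1 * (t + 2 * r - 1) <= r * (t + 2 * s + 1) by nia.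
  have h3 := leq_mul (leqnn (k - t + 1)) h2.
  rewrite mulnCA [X in _ < X]mulnCA.
  by apply: leq_trans h3; rewrite [X in _ < X]mulnCA.
rewrite mulnBr ltn_subLR ?leq_mul2l ?ln ?orbT // -mulnDl.
by move: key; rewrite (_ : t + 2 * s + 1 = l.+1) 1?(_ : s.+1 + (k - t - s) = k - t + 1); lia.
Qed.

(* The pushing step for the family of complements, an optimal
   (n + t - 2k)-intersecting family of (n - k)-sets. *)
Lemma swap_closed_cosegment F r : set_optimal k t F -> compressed F ->
  k <= n -> 2 * k + 2 <= n + t -> 0 < t <= k ->
  (k - t + 1) * (t + 2 * r + 1) < r.+1 * n ->
  swap_closed (~: segment n (t + 2 * r)) (mem F).
Proof.
move=> optF cF kn ktn /andP[t0 tk] lower.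
have optC := set_optimal_setC kn (leq_trans (leq_addr 2 _) ktn) optF.
have inC A : (A \in @setC _ @: F) = (~: A \in F).
  by rewrite -[A in LHS]setCK mem_imset; last exact: setC_inj.
suff H d : d <= n - (t + 2 * r) -> swap_closed (~: segment n (n - d)) (mem F).
  case: (leqP (t + 2 * r) n) => [le|gt].
    by have := H _ (leqnn _); rewrite subKn.
  by move=> A x y _; rewrite !inE -leqNgt => lx; have := ltn_ord x; lia.
elim: d => [|d IH] dn.
  move=> A x y _; rewrite !inE -leqNgt subn0 => lx; have := ltn_ord x; lia.
have ln : n - d.+1 < n by lia.
pose e := Ordinal ln; set Y := ~: segment n (n - d).
have eY : e \notin Y by rewrite !inE /= -ltnNge ltnNge; lia.
have -> : ~: segment n (n - d.+1) = e |: Y.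
  by apply/setP => x; rewrite !inE -val_eqE /=; lia.
have FY : swap_closed Y (mem F) := IH (ltnW dn).
have CY := swap_closedC FY.
have cY : #|Y| = d.
  have := cardsC (segment n (n - d)); rewrite card_ord card_segment ?leq_subr // /Y; lia.
have up y : y \in Y -> e < y by rewrite !inE /=; lia.
have eC A y : A \in F -> y \in Y -> e \in A -> y \notin A -> swap A e y \in F.
  move=> FA yY eA yA.
  have := @pushing _ _ _ _ _ e optC eY CY.
  move=> push; have := push _ _ _ (~: A) y; rewrite !inC setCK.
  rewrite swapC ?inE ?negbK // setCK; apply => //.
  - move=> B z; rewrite inC => FB zY zB eB.
    rewrite inC -[B]setCK swapC ?inE ?zB // setCK.
    apply: cF => //; rewrite ?inE ?zB ?eB //.
    move: zY; rewrite !inE negbK /= => lz.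
    have : z != e by apply: contraNneq eB => <-.
    rewrite -val_eqE /=; lia.
  - lia.
  - rewrite cY card_ord => i id ei.
    clear - lower ktn kn id ei dn tk t0.
    have [s sE] : exists s, i = n + t - 2 * k + s by exists (i - (n + t - 2 * k)); lia.
    have dE : d = n + t - 2 * k + 2 * s by lia.
    (* The index [p] translates back from the complements: the pushing condition for (n - k, n + t -
       2k) at [s] becomes n > [threshold k t p.+1], which follows from the bound at r + 1 since p >=
       r. *)
    have [p pE] : exists p, k - t = s + p.+1 by exists (k - t - s).-1; lia.
    have -> : (d - i).+1 = s.+1 by lia.
    have -> : n - d.+1 = t + 2 * p + 1 by lia.
    have -> : n - k - i = p.+1 by lia.
    have rp : r <= p by lia.
    have -> : d.+1 = n - (t + 2 * p + 1) by lia.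
    have key : (k - t + 1) * (t + 2 * p + 1) < p.+1 * n.
      rewrite -(ltn_pmul2l (ltn0Sn r)).
      have h1 : p.+1 * ((k - t + 1) * (t + 2 * r + 1)) < p.+1 * (r.+1 * n).
        by rewrite ltn_pmul2l.
      have h2 : r.+1 * (t + 2 * p + 1) <= p.+1 * (t + 2 * r + 1).
        have [u ->] : exists u, t = u.+1 by exists t.-1; lia.
        have : r * u <= p * u by rewrite leq_mul2r rp orbT.
        nia.
      have h3 := leq_mul (leqnn (k - t + 1)) h2.
      rewrite mulnCA [X in _ < X]mulnCA.
      by apply: leq_ltn_trans h3 _; rewrite mulnCA.
    rewrite mulnBr ltn_subRL -mulnDl; apply: leq_ltn_trans key.
    by rewrite leq_mul2r; lia.
  - by move: yY; rewrite !inE.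
apply: (@swap_closedU1 _ Y e (mem F) FY) => [A y FA yY eA yA|A y FA yY yA eA].
  exact: eC.
by apply: cF => //; apply: up.
Qed.

(** * From invariance to the Frankl families *)

Definition set_frankl r : {set {set 'I_n}} :=
  [set A : {set 'I_n} | (#|A| == k) && (t + r <= #|A :&: segment n (t + 2 * r)|)].

Lemma set_frankl_family r : t + 2 * r <= n -> set_family k t (set_frankl r).
Proof.
move=> le_n; split=> [A|A B]; rewrite !inE; first by case/andP => /eqP.
move=> /andP[_ hA] /andP[_ hB]; set X := segment n (t + 2 * r) in hA hB.
have cX : #|X| = t + 2 * r by rewrite card_segment.
have := cardsUI (A :&: X) (B :&: X).
have : #|A :&: X :|: B :&: X| <= #|X| by rewrite subset_leq_card // subUset !subsetIr.
have : #|(A :&: X) :&: (B :&: X)| <= #|A :&: B|.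
  by rewrite setIACA setIid subset_leq_card // subsetIl.
mlia.
Qed.

Lemma segmentS (e : 'I_n) : segment n e.+1 = e |: segment n e.
Proof. by apply/setP => x; rewrite !inE ltnS leq_eqVlt -val_eqE. Qed.

Lemma card_setI_segmentS A (e : 'I_n) :
  #|A :&: segment n e.+1| = #|A :&: segment n e| + (e \in A).
Proof.
rewrite segmentS (cardsD1 e) inE setU11 andbT addnC; congr (_ + _).
apply: eq_card => x; rewrite !inE -val_eqE /=.
by case: (x \in A); rewrite ?andbF //=; lia.
Qed.

Lemma exists_max_level (X : {set 'I_n}) (P : pred {set 'I_n}) A : P A ->
  exists2 B, P B & forall C, P C -> #|C :&: X| <= #|B :&: X|.
Proof.
by move=> PA; case: (arg_maxnP (fun B => #|B :&: X|) PA) => B PB maxB; exists B.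
Qed.

(** Among the members with fewer than [t + r] points in the segment, one with the most has exactly t
    + r - 1, since compression could move another point in. Rearranged against itself on both sides
    of the segment, it overlaps in at most max(t - 2, 0) points inside and, as 2k + 2 <= n + t, in
    none outside. *)
Lemma sub_set_frankl F r : set_family k t F -> compressed F ->
  0 < t <= k -> r <= k - t -> 2 * k + 2 <= n + t ->
  swap_closed (segment n (t + 2 * r)) (mem F) ->
  swap_closed (~: segment n (t + 2 * r)) (mem F) -> F \subset set_frankl r.
Proof.
move=> [cF iF] comF /andP[t0 tk] rkt ktn; set X := segment n _ => FX FX'.
have cX : #|X| = t + 2 * r by rewrite card_segment //; lia.
have cX' : #|~: X| = n - (t + 2 * r) by have := cardsC X; rewrite card_ord cX; lia.
apply/subsetP => A0 FA0; rewrite inE cF // eqxx /= leqNgt; apply/negP => lt0.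
pose P := [pred A | (A \in F) && (#|A :&: X| < t + r)].
have [A /andP[/= FA ltA] maxA] : exists2 B, P B & forall C, P C -> #|C :&: X| <= #|B :&: X|.
  by apply: (@exists_max_level _ _ A0); rewrite /= FA0.
have cA := cF _ FA; have cAX := cardsID X A.
case: (ltnP #|A :&: X|.+1 (t + r)) => [lt|ge].
  have /set0Pn[z] : A :\: X != set0 by rewrite -cards_eq0; mlia.
  rewrite !inE -leqNgt => /andP[zX zA].
  have /set0Pn[x] : X :\: A != set0.
    by rewrite -cards_eq0; have := cardsID A X; rewrite setIC cX; mlia.
  rewrite !inE => /andP[xA xX].
  have := card_swapI X zA xA; rewrite !inE xX [z < _]ltnNge zX /= addn0 addn1 => e.
  have : P (swap A z x) by rewrite /= e lt andbT; apply: comF => //; apply: leq_trans zX.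
  by move/maxA; rewrite e ltnn.
have [|B FB] := @swap_closed2_rearrange _ X (~: X) F A A _ FX FX' FA.
  exact: setICr.
rewrite setUCr setDT cards0 addn0 cX cX' -!setDE => cB.
have := iF _ _ FA FB; move: cAX cB ltA ge; rewrite cA.
move: #|A :&: X| #|A :\: X| #|A :&: B| => a b c; clear -rkt ktn t0 tk; lia.
Qed.

(** The argument of [sub_set_frankl] with two points [e1], [e2] under no known symmetry: their
    contribution to an intersection cannot be rearranged away and is carried as a separate term. *)
Lemma sub_set_frankl2 F r : set_family k t F -> compressed F ->
  1 < t <= k -> r < k - t -> 2 * k + 2 <= n + t ->
  swap_closed (segment n (t + 2 * r)) (mem F) ->
  swap_closed (~: segment n (t + 2 * r.+1)) (mem F) ->
  F \subset set_frankl r \/ F \subset set_frankl r.+1.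
Proof.
move=> [cF iF] comF /andP[t1 tk] rkt ktn; set X := segment n (t + 2 * r).
set Z := ~: _ => FX FZ.
have u1n : t + 2 * r < n by lia.
have u2n : (t + 2 * r).+1 < n by lia.
pose e1 := Ordinal u1n; pose e2 := Ordinal u2n.
have cX : #|X| = t + 2 * r by rewrite card_segment //; lia.
have eW : segment n (t + 2 * r.+1) = segment n e2.+1 by rewrite /=; congr segment; lia.
have cW A : #|A :&: segment n (t + 2 * r.+1)| = #|A :&: X| + (e1 \in A) + (e2 \in A).
  by rewrite eW card_setI_segmentS (card_setI_segmentS A e1).
have cZ : #|Z| = n - (t + 2 * r).+2.
  have := cardsC (segment n (t + 2 * r.+1)); rewrite card_ord card_segment -/Z; lia.
have cAZ A : A \in F -> #|A :&: X| + (e1 \in A) + (e2 \in A) + #|A :&: Z| = k.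
  by move=> FA; rewrite -cW -(cF _ FA) -[in RHS](cardsID (segment n (t + 2 * r.+1))) -setDE.
have dXZ : X :&: Z = set0.
  by apply/setP => x; rewrite !inE; apply/negP => /andP[]; lia.
have e1X : e1 \notin X by rewrite inE /= ltnn.
have e2X : e2 \notin X by rewrite inE /= ltnNge leqnSn.
have midE A B : #|(A :&: B) :\: (X :|: Z)| = (e1 \in A :&: B) + (e2 \in A :&: B).
  rewrite -setDDl; have := cardsID X (A :&: B); have := cW (A :&: B).
  have := cardsID Z ((A :&: B) :\: X).
  have -> : ((A :&: B) :\: X) :&: Z = (A :&: B) :\: segment n (t + 2 * r.+1).
    by apply/setP => x; rewrite !inE; case: (x \in A); case: (x \in B); rewrite ?andbF //=;
      lia.
  by have := cardsID (segment n (t + 2 * r.+1)) (A :&: B); mlia.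
have small A B : A \in F -> B \in F ->
    t <= (#|A :&: X| + #|B :&: X| - (t + 2 * r))
         + (#|A :&: Z| + #|B :&: Z| - (n - (t + 2 * r).+2))
         + ((e1 \in A :&: B) + (e2 \in A :&: B)).
  move=> FA FB; have [B' FB' eB'] := swap_closed2_rearrange A dXZ FX FZ FB.
  by have := iF _ _ FA FB'; rewrite eB' midE cX cZ.
(* The exempted sets, with t + r - 1 points in [X] and both [e1] and [e2], are those of the next
   Frankl family outside the current one. *)
pose bad A := [&& A \in F, #|A :&: X| < t + r &
  ~~ [&& #|A :&: X|.+1 == t + r, e1 \in A & e2 \in A]].
have nobad A : ~~ bad A.
  apply/negP => /(@exists_max_level X)[{}A /and3P[FA ltA nA] maxA].
  have cA := cF _ FA; have cAX := cardsID X A.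
  have /set0Pn[z0] : A :\: X != set0 by rewrite -cards_eq0; mlia.
  rewrite !inE -leqNgt => /andP[z0X z0A].
  case: (ltnP #|A :&: X|.+1 (t + r)) => [lt|ge].
    have /set0Pn[x] : X :\: A != set0.
      by rewrite -cards_eq0; have := cardsID A X; rewrite setIC cX; mlia.
    rewrite !inE => /andP[xA xX].
    (* The point moved into [X] is [e1] whenever possible, so that [e1] is absent afterwards and the
       new set is still bad. *)
    have [z [zA zX e1z]] : exists z : 'I_n, [/\ z \in A, t + 2 * r <= z &
        (e1 == z) || (e1 \notin A)].
      case: (boolP (e1 \in A)) => e1A; first by exists e1; rewrite eqxx.
      by exists z0; rewrite orbT.
    have := card_swapI X zA xA; rewrite !inE xX [z < _]ltnNge zX /= addn0 addn1 => e.
    have : bad (swap A z x).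
      rewrite /bad e lt comF ?(leq_trans xX) //= negb_and; apply/orP; right.
      rewrite negb_and in_swap negb_or negb_and; apply/orP; left; apply/andP; split.
        by apply: contraNneq e1X => ->; rewrite inE.
      by case/orP: e1z => ->; rewrite ?orbT.
    by move/maxA; rewrite e ltnn.
  (* Compression normalizes a bad set of maximal level to contain [e1] and not [e2]. A rearranged
     copy then meets it in only (t - 2) + 0 + 1 points. *)
  have [A' [FA' cA' e1A' e2A']] : exists A', [/\ A' \in F, #|A' :&: X|.+1 = t + r,
      e1 \in A' & e2 \notin A'].
    have eA : #|A :&: X|.+1 = t + r by apply/eqP; rewrite eqn_leq ge ltA.
    move: nA; rewrite eA eqxx /= negb_and.
    case: (boolP (e1 \in A)) => e1A /= e2A; first by exists A.
    have [z [zA zX e2z]] : exists z : 'I_n, [/\ z \in A, t + 2 * r <= z &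
        (e2 == z) || (e2 \notin A)].
      case: (boolP (e2 \in A)) => e2A'; first by exists e2; rewrite eqxx /= leqnSn.
      by exists z0; rewrite orbT.
    exists (swap A z e1); split.
    - apply: comF => //; rewrite ltn_neqAle zX andbT.
      by apply: contraNneq e1A => e1z; have -> : e1 = z by apply: val_inj.
    - by have := card_swapI X zA e1A; rewrite (negbTE e1X) !inE [z < _]ltnNge zX /= !addn0 => ->.
    - by rewrite in_swap eqxx.
    - rewrite in_swap negb_or negb_and -val_eqE /= gtn_eqF //=.
      by case/orP: e2z => ->; rewrite ?orbT.
  have := small _ _ FA' FA'; have := cAZ _ FA'.
  rewrite !inE e1A' (negbTE e2A') /=.
  clear - cA' t1 tk rkt ktn; mlia.
have bigF A : A \in F -> #|A :&: X| < t + r -> [/\ #|A :&: X|.+1 = t + r, e1 \in A & e2 \in A].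
  by move=> FA lt; have := nobad A; rewrite /bad FA lt negbK => /and3P[/eqP].
case: (boolP [exists A in F, #|A :&: X| < t + r]) => [/existsP[A /andP[FA ltA]]|].
  (* Once an exempted set [A] is present, a [B] with exactly [t + r] points in [X] and neither [e1]
     nor [e2] could be rearranged to meet [A] in t - 1 points. *)
  right; apply/subsetP => B FB; rewrite inE cF // eqxx /= cW.
  have [cA e1A e2A] := bigF _ FA ltA.
  case: (ltnP #|B :&: X| (t + r)) => [/(bigF _ FB)[cB -> ->]|geB]; first by mlia.
  rewrite leqNgt; apply/negP => lt.
  have [e1B e2B] : (e1 \in B) = false /\ (e2 \in B) = false.
    by move: lt; case: (e1 \in B); case: (e2 \in B) => //=; mlia.
  have := small _ _ FA FB; have := cAZ _ FA; have := cAZ _ FB.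
  rewrite !inE e1A e2A e1B e2B /=; rewrite e1B e2B in lt.
  clear - cA lt geB t1 tk rkt ktn; mlia.
move=> /existsPn H; left; apply/subsetP => A FA; rewrite inE cF // eqxx /=.
by have := H A; rewrite FA /= -leqNgt.
Qed.
End CompleteIntersection.

(** * Sizes of Frankl families and extremal compressed families of sets *)

Section CompleteIntersectionTheorem.
Variables (n k t : nat).
Implicit Types (A B : {set 'I_n}) (F : {set {set 'I_n}}).

(** The two differences of the families are the classes with (t + r; neither point) and (t + r - 1;
    both [e1] and [e2]). Both are compared with the class (t + r - 1; [e1] only), by exchanging a
    point of [X] with [e1] and a point of [Z] with [e2]. *)
Lemma card_set_frankl_succ r : 0 < t <= k -> r < k - t ->
  r.+1 * n = (k - t + 1) * (t + 2 * r + 1) -> 2 * k < n + t ->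
  #|set_frankl n k t r| = #|set_frankl n k t r.+1|.
Proof.
move=> /andP[t0 tk] rkt eqn ktn; set X := segment n (t + 2 * r).
set W := segment n (t + 2 * r.+1); set Z := ~: W.
have u1n : t + 2 * r < n by lia.
have u2n : (t + 2 * r).+1 < n by lia.
pose e1 := Ordinal u1n; pose e2 := Ordinal u2n.
have cX : #|X| = t + 2 * r by rewrite card_segment //; lia.
have eW : W = segment n e2.+1 by rewrite /W /=; congr segment; lia.
have cW A : #|A :&: W| = #|A :&: X| + (e1 \in A) + (e2 \in A).
  by rewrite eW card_setI_segmentS (card_setI_segmentS A e1).
have cZ : #|Z| = n - (t + 2 * r).+2.
  have := cardsC W; rewrite card_ord card_segment -/Z; lia.
have cAZ A : #|A :&: X| + (e1 \in A) + (e2 \in A) + #|A :&: Z| = #|A|.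
  by rewrite -cW -[in RHS](cardsID W) -setDE.
have e1X : e1 \notin X by rewrite inE /= ltnn.
have e2X : e2 \notin X by rewrite inE /= ltnNge leqnSn.
have e1Z : e1 \notin Z by rewrite !inE /= negbK; lia.
have e2Z : e2 \notin Z by rewrite !inE /= negbK; lia.
have XZ x : x \in X -> x \notin Z by rewrite !inE negbK; lia.
have n12 : e1 != e2 by rewrite -val_eqE /=; lia.
pose L a (b1 b2 : bool) := [set A : {set 'I_n} |
  [&& #|A| == k, #|A :&: X| == a, (e1 \in A) == b1 & (e2 \in A) == b2]].
have inL A a b1 b2 : (A \in L a b1 b2) =
  [&& #|A| == k, #|A :&: X| == a, (e1 \in A) == b1 & (e2 \in A) == b2] by rewrite inE.
have d1 : (t + r) * #|L (t + r) false false| = r.+1 * #|L (t + r).-1 true false|.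
  have -> : r.+1 = (#|X| - (t + r)).+1 by rewrite cX; lia.
  apply: (@swap_double_count _ X e1) => //; first by rewrite cX; lia.
  - by move=> A; rewrite inL => /and4P[_ /eqP -> /eqP -> _].
  - by move=> A; rewrite inL => /and4P[_ /eqP -> /eqP -> _]; rewrite prednK // addn_gt0 t0.
  - move=> A y; rewrite !inL => /and4P[/eqP cA /eqP cAX /eqP e1A /eqP e2A] yX yA.
    have ny1 : e2 != y by apply: contraNneq e2X => ->.
    have := card_swapI X yA (negbT e1A); rewrite yX (negbTE e1X) cAX => cs.
    rewrite card_swap ?e1A // cA !in_swap !eqxx e2A andbF orbF [e2 == _]eq_sym (negbTE n12) /=.
    by rewrite andbT; apply/eqP; mlia.
  - move=> A y; rewrite !inL => /and4P[/eqP cA /eqP cAX /eqP e1A /eqP e2A] yX yA.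
    have ny1 : e1 != y by apply: contraNneq e1X => ->.
    have ny2 : e2 != y by apply: contraNneq e2X => ->.
    have := card_swapI X e1A yA; rewrite yX (negbTE e1X) cAX => cs.
    rewrite card_swap // cA !in_swap !eqxx e2A andbF orbF (negbTE ny1) (negbTE ny2) /=.
    by rewrite !andbT; apply/eqP; mlia.
have d2 : (k - (t + r)) * #|L (t + r).-1 true false| =
    (n - k - r.+1) * #|L (t + r).-1 true true|.
  have -> : n - k - r.+1 = (#|Z| - (k - (t + r))).+1 by rewrite cZ; lia.
  apply: (@swap_double_count _ Z e2) => //; first by rewrite cZ; lia.
  - move=> A; rewrite inL => /and4P[/eqP cA /eqP cAX /eqP e1A /eqP e2A]; rewrite e2A.
    by split=> //; have := cAZ A; rewrite e1A e2A cA cAX /=; mlia.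
  - move=> A; rewrite inL => /and4P[/eqP cA /eqP cAX /eqP e1A /eqP e2A]; rewrite e2A.
    by split=> //; have := cAZ A; rewrite e1A e2A cA cAX /=; mlia.
  - move=> A y; rewrite !inL => /and4P[/eqP cA /eqP cAX /eqP e1A /eqP e2A] yZ yA.
    have yX : y \notin X by apply: contraL yZ; apply: XZ.
    have ny1 : e1 != y by apply: contraNneq e1Z => ->.
    have := card_swapI X yA (negbT e2A); rewrite (negbTE yX) (negbTE e2X) cAX !addn0 => ->.
    by rewrite card_swap ?e2A // cA !in_swap !eqxx e1A (negbTE n12) ny1.
  - move=> A y; rewrite !inL => /and4P[/eqP cA /eqP cAX /eqP e1A /eqP e2A] yZ yA.
    have yX : y \notin X by apply: contraL yZ; apply: XZ.
    have ny2 : e2 != y by apply: contraNneq e2Z => ->.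
    have := card_swapI X e2A yA; rewrite (negbTE yX) (negbTE e2X) cAX !addn0 => ->.
    by rewrite card_swap // cA !in_swap !eqxx e1A n12 (negbTE ny2) orbT.
have -> : #|set_frankl n k t r| = #|set_frankl n k t r :&: set_frankl n k t r.+1|
    + #|L (t + r) false false|.
  rewrite -(cardsID (set_frankl n k t r.+1)); congr (_ + _); apply: eq_card => A.
  rewrite inL !inE -/W -/X cW; case: (e1 \in A); case: (e2 \in A) => /=; mlia.
have -> : #|set_frankl n k t r.+1| = #|set_frankl n k t r :&: set_frankl n k t r.+1|
    + #|L (t + r).-1 true true|.
  rewrite setIC -(cardsID (set_frankl n k t r)); congr (_ + _); apply: eq_card => A.
  rewrite inL !inE -/W -/X cW; case: (e1 \in A); case: (e2 \in A) => /=; mlia.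
congr (_ + _).
(* The threshold equation rewritten as equality of the two products of double-counting
   coefficients. *)
have key : r.+1 * (n - k - r.+1) = (t + r) * (k - (t + r)).
  clear - eqn tk rkt ktn t0.
  have [q kE] : exists q, k = t + r + q by exists (k - t - r); lia.
  have [p nE] : exists p, n = t + 2 * r + 1 + q + p by exists (n - (t + 2 * r + 1 + q)); lia.
  have -> : n - k - r.+1 = p by lia.
  have -> : k - (t + r) = q by lia.
  move: eqn; have -> : k - t + 1 = r + q + 1 by lia.
  rewrite nE; nia.
have pos : 0 < (t + r) * (k - (t + r)) by rewrite muln_gt0; lia.
apply/eqP; rewrite -(eqn_pmul2l pos) -[X in _ == X * _]key.
by rewrite mulnAC d1 -!mulnA [_ * (k - _)]mulnC d2.
Qed.

(** Since k - t + 1 >= r + 1, the threshold is at least 2(k - t + 1) + (t - 1) = 2k - t + 1, and n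
    exceeds it. *)
Lemma set_frankl_lower_bound r : 0 < t <= k -> r <= k - t ->
  (k - t + 1) * (t + 2 * r + 1) < r.+1 * n -> 2 * k + 2 <= n + t.
Proof.
move=> /andP[t0 tk] rkt lower; rewrite leqNgt; apply/negP => lt.
have [u tE] : exists u, t = u.+1 by exists t.-1; lia.
have h1 : r.+1 * n <= r.+1 * (2 * (k - t + 1) + u) by rewrite leq_mul2l; lia.
have h2 : r.+1 * u <= (k - t + 1) * u by rewrite leq_mul2r; lia.
move: lower; rewrite {2}tE; move: h1 h2; move: (k - t + 1) => K; nia.
Qed.

(** For [t = 1] both thresholds are 2k, and no n lies strictly between them. *)
Lemma set_frankl_gt1 r : 0 < t -> 0 < r ->
  (k - t + 1) * (t + 2 * r + 1) < r.+1 * n ->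
  r * n < (k - t + 1) * (t + 2 * r - 1) -> 1 < t.
Proof.
move=> t0 r0 lower upper; rewrite ltn_neqAle t0 andbT; apply/eqP => t1.
move: lower upper; rewrite -t1; move: (k - 1 + 1) => K; case: r r0 => // r _.
rewrite (_ : 1 + 2 * r.+1 - 1 = r.+1 * 2); last lia.
rewrite (_ : 1 + 2 * r.+1 + 1 = r.+2 * 2); last lia.
by rewrite mulnCA ltn_mul2l mulnCA ltn_mul2l /=; lia.
Qed.

Lemma complete_intersection_strict r : 0 < t <= k -> r <= k - t ->
  (k - t + 1) * (t + 2 * r + 1) < r.+1 * n ->
  (0 < r -> r * n < (k - t + 1) * (t + 2 * r - 1)) ->
  (forall F, set_optimal k t F -> compressed F -> F = set_frankl n k t r) /\
  (forall F, set_family k t F -> #|F| <= #|set_frankl n k t r|).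
Proof.
move=> htk rkt lower upper.
have ktn := set_frankl_lower_bound htk rkt lower; have /andP[t0 tk] := htk.
have t_cases : 1 < t \/ t = 1 /\ r = 0.
  case: (posnP r) => [r0|r0]; last by left; apply: (set_frankl_gt1 (r := r)) => //; apply: upper.
  by case: (ltngtP t 1) => [|?|t1]; [lia|left|right].
have main F : set_optimal k t F -> compressed F -> F = set_frankl n k t r.
  move=> optF cF; have [famF maxF] := optF.
  apply/eqP; rewrite eqEcard maxF; last by apply: set_frankl_family; lia.
  rewrite andbT; apply: sub_set_frankl => //.
    by apply: (swap_closed_segment optF cF (erefl _)) => //; lia.
  by apply: (swap_closed_cosegment optF cF) => //; lia.
split=> // F famF; have [F' optF' cF'] := exists_optimal n k t.
by rewrite -(main F') //; case: optF' => _; apply.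
Qed.

Lemma complete_intersection_boundary r : 1 < t <= k -> r < k - t ->
  r.+1 * n = (k - t + 1) * (t + 2 * r + 1) ->
  [/\ forall F, set_optimal k t F -> compressed F ->
        F = set_frankl n k t r \/ F = set_frankl n k t r.+1,
      forall F, set_family k t F -> #|F| <= #|set_frankl n k t r| &
      #|set_frankl n k t r| = #|set_frankl n k t r.+1|].
Proof.
move=> /andP[t1 tk] rkt eqn.
have ktn : 2 * k + 2 <= n + t.
  rewrite leqNgt; apply/negP => lt.
  have [u tE] : exists u, t = u.+2 by exists t.-2; lia.
  have h1 : r.+1 * n <= r.+1 * (2 * (k - t + 1) + u.+1) by rewrite leq_mul2l; lia.
  have h2 : r.+1 * u.+1 < (k - t + 1) * u.+1 by rewrite ltn_mul2r; lia.
  move: eqn; rewrite {2}tE; move: h1 h2; move: (k - t + 1) => K; nia.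
have card_eq : #|set_frankl n k t r| = #|set_frankl n k t r.+1|.
  by apply: card_set_frankl_succ => //; lia.
(* For [t > 1] thresholds strictly decrease with the index, so equality at r + 1 gives strict bounds
   at r + 2 and at [r]. *)
have lower : (k - t + 1) * (t + 2 * r.+1 + 1) < r.+2 * n.
  rewrite -(ltn_pmul2l (ltn0Sn r)) [X in _ < X]mulnCA eqn.
  rewrite mulnCA [X in _ < X]mulnCA ltn_pmul2l ?addn1 //.
  clear -t1; nia.
have upper : 0 < r -> r * n < (k - t + 1) * (t + 2 * r - 1).
  move=> r0; rewrite -(ltn_pmul2l (ltn0Sn r)) mulnCA eqn.
  rewrite mulnCA [X in _ < X]mulnCA ltn_pmul2l ?addn1 //.
  have -> : t + 2 * r - 1 = t - 1 + 2 * r by lia.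
  clear -t1 r0; have [u ->] : exists u, t = u.+2 by [exists t.-2; lia].
  rewrite subn1 /=; nia.
have main F : set_optimal k t F -> compressed F ->
    F = set_frankl n k t r \/ F = set_frankl n k t r.+1.
  move=> optF cF; have [famF maxF] := optF.
  have [|||||sub|sub] // := @sub_set_frankl2 n k t F r famF cF.
  - by rewrite t1.
  - by apply: (swap_closed_segment optF cF (erefl _)) => //; [lia|lia|left].
  - by apply: (swap_closed_cosegment optF cF) => //; lia.
  - left; apply/eqP; rewrite eqEcard sub maxF //.
    by apply: set_frankl_family; lia.
  - right; apply/eqP; rewrite eqEcard sub maxF //.
    by apply: set_frankl_family; lia.
split=> // F famF; have [F' optF' cF'] := exists_optimal n k t.
have [_ maxF'] := optF'.
by case: (main F' optF' cF') => eF'; [rewrite -eF'|rewrite card_eq -eF']; apply: maxF'.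
Qed.
End CompleteIntersectionTheorem.

(** * Multisets as finite functions *)

Lemma lex_ltn M a a' b b' : a' < a -> b' < M -> M * a' + b' < M * a + b.
Proof.
move=> lta ltb; apply: leq_trans (_ : M * a' + M <= _).
  by rewrite -addnS leq_add2l.
by rewrite addnC -mulnS (leq_trans _ (leq_addr _ _)) // leq_mul2l lta orbT.
Qed.

Section Multisets.
Variables (m k : nat).
Local Notation ms := {ffun 'I_m -> 'I_k.+1}.
Implicit Types (A B C T : ms) (i j x y : 'I_m) (s : nat) (F : {set ms}).

Definition mcard A := \sum_x A x.
Definition mcap A B := \sum_x minn (A x) (B x).
Definition msupp A : {set 'I_m} := [set x | 0 < A x].
Definition kmset : {set ms} := [set A | mcard A == k].
(** [inord] sends a value above [k] to 0, so each use needs the bound [g x <= k]. Capping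
    multiplicities at [k] makes the type finite and loses no [k]-multiset. *)
Definition mset_fun (g : 'I_m -> nat) : ms := [ffun x => inord (g x)].

Lemma mset_funE (g : 'I_m -> nat) x : g x <= k -> mset_fun g x = g x :> nat.
Proof. by move=> gk; rewrite ffunE inordK. Qed.

Lemma in_kmset A : (A \in kmset) = (mcard A == k).
Proof. by rewrite inE. Qed.

Lemma in_msupp A x : (x \in msupp A) = (0 < A x).
Proof. by rewrite inE. Qed.

Lemma mcapC : commutative mcap.
Proof. by move=> A B; apply: eq_bigr => x _; rewrite minnC. Qed.

Lemma sum_pair i j (g : 'I_m -> nat) : i != j ->
  \sum_x g x = g i + g j + \sum_(x | (x != i) && (x != j)) g x.
Proof.
move=> nij; rewrite (bigD1 i) //= (bigD1 j) /=; last by rewrite eq_sym.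
by rewrite addnA; congr (_ + _).
Qed.

Lemma mset_fun_eq A B : (forall x, A x = B x :> nat) -> A = B.
Proof. by move=> e; apply/ffunP => x; apply: val_inj; apply: e. Qed.

(* The reflection (a, b) |-> (b + s, a - s) of the multiplicities of i and j,
   where it is defined.  It is used with s = 0, for j < i, as a compression and
   with s = 1 to even out multiplicities. *)
Definition transfer i j s A : ms :=
  if s <= A i then
    mset_fun (fun x => if x == i then A j + s else if x == j then A i - s else A x)
  else A.

Section Transfer.
Variables (i j : 'I_m) (s : nat).
Hypothesis nij : i != j.

Lemma mcard_pair A : mcard A <= k -> A i + A j <= k.
Proof. by rewrite /mcard (sum_pair _ nij); lia. Qed.

Lemma transferE A : mcard A <= k -> s <= A i ->
  [/\ transfer i j s A i = A j + s :> nat, transfer i j s A j = A i - s :> nat &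
      forall x, x != i -> x != j -> transfer i j s A x = A x].
Proof.
move=> /mcard_pair Ak sA; rewrite /transfer sA; split.
- by rewrite mset_funE eqxx //; lia.
- by rewrite mset_funE [j == i]eq_sym (negbTE nij) eqxx //; lia.
- move=> x xi xj; apply: val_inj => /=.
  by rewrite mset_funE (negbTE xi) (negbTE xj) // -ltnS.
Qed.

Lemma transfer_id A : A i < s -> transfer i j s A = A.
Proof. by rewrite /transfer ltnNge => /negbTE ->. Qed.

Lemma mcard_transfer A : mcard A <= k -> mcard (transfer i j s A) = mcard A.
Proof.
move=> Ak; case: (leqP s (A i)) => sA; last by rewrite transfer_id.
have [ei ej ex] := transferE Ak sA.
rewrite /mcard !(sum_pair _ nij) ei ej; congr (_ + _); first by lia.
by apply: eq_bigr => x /andP[xi xj]; rewrite ex.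
Qed.

Lemma transferK A : mcard A <= k -> transfer i j s (transfer i j s A) = A.
Proof.
move=> Ak; case: (leqP s (A i)) => sA; last by rewrite !transfer_id.
have [ei ej ex] := transferE Ak sA.
have [||fi fj fx] := @transferE (transfer i j s A); first by rewrite mcard_transfer.
  by rewrite ei leq_addl.
apply: mset_fun_eq => x.
case: (eqVneq x i) => [->|xi]; first by rewrite fi ej subnK.
case: (eqVneq x j) => [->|xj]; first by rewrite fj ei addnK.
by rewrite fx // ex.
Qed.

Definition transfer_far A := A j + s < A i.

Lemma mcap_transfer A B : mcard A <= k -> s <= A i -> mcap (transfer i j s A) B =
  minn (A j + s) (B i) + minn (A i - s) (B j) +
  \sum_(x | (x != i) && (x != j)) minn (A x) (B x).
Proof.
move=> Ak sA; have [ei ej ex] := transferE Ak sA.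
rewrite /mcap (sum_pair _ nij) ei ej; congr (_ + _).
by apply: eq_bigr => x /andP[xi xj]; rewrite ex.
Qed.

(** After subtracting [s] from the multiplicity at [i], the transfer swaps two coordinates. For [A]
    far and [B] not, the swap puts the two pairs in the same order, and pairing larger with larger
    does not decrease a sum of minima. *)
Lemma transfer_polarization :
  polarization mcap kmset transfer_far (transfer i j s).
Proof.
have leU A : A \in kmset -> mcard A <= k by rewrite in_kmset => /eqP ->.
have far_s A : transfer_far A -> s <= A i.
  by rewrite /transfer_far => far; apply: leq_trans (ltnW far); apply: leq_addl.
split.
- move=> A UA; rewrite transferK ?leU //; split=> //.
  by move: UA; rewrite !in_kmset => /eqP cA; rewrite mcard_transfer ?cA.
- move=> A UA far; have [ei ej ex] := transferE (leU _ UA) (far_s _ far).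
  by rewrite /transfer_far ei ej -leqNgt subnK ?far_s // ltnW.
- move=> A B UA UB fA fB.
  have [ei ej ex] := transferE (leU _ UB) (far_s _ fB).
  have sA := far_s _ fA; have sB := far_s _ fB.
  rewrite !mcap_transfer ?leU // ei ej.
  rewrite [mcap A (transfer _ _ _ _)]mcapC mcap_transfer ?leU //; split.
    rewrite /mcap (sum_pair _ nij); congr (_ + _); first by lia.
    by apply: eq_bigr => x /andP[xi xj]; rewrite ex.
  congr (_ + _); first by lia.
  by apply: eq_bigr => x _; rewrite minnC.
- move=> A B UA UB fA; rewrite /transfer_far -leqNgt => nB.
  rewrite mcap_transfer ?leU ?far_s // /mcap (sum_pair _ nij) leq_add2r.
  by move: fA nB; rewrite /transfer_far; lia.
Qed.

End Transfer.

(** Evening out (s = 1) is allowed in both directions, since it lowers the sum of squares. Plain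
    exchanges (s = 0) go only towards smaller indices, otherwise the process need not end. *)
Definition transfer_ok (o : 'I_m * 'I_m * bool) :=
  (o.1.1 != o.1.2) && (o.2 || (o.1.2 < o.1.1)).

Definition op_far (o : 'I_m * 'I_m * bool) A :=
  transfer_ok o && transfer_far o.1.1 o.1.2 o.2 A.

Definition op_transfer (o : 'I_m * 'I_m * bool) A :=
  if transfer_ok o then transfer o.1.1 o.1.2 o.2 A else A.

Lemma op_polarization o : polarization mcap kmset (op_far o) (op_transfer o).
Proof.
rewrite /op_far /op_transfer; case: (boolP (transfer_ok o)) => [/andP[nij _]|_] /=.
  exact: transfer_polarization.
by split.
Qed.

(** A lexicographic order in one number: the second sum is at most m k on [k]-multisets. The
    operations with s = 1 lower the sum of squares; those with s = 0 preserve it and lower the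
    second sum. *)
Definition transfer_weight A :=
  (m * k).+1 * (\sum_x A x * A x) + \sum_(x : 'I_m) x * A x.

Lemma op_weight o A : A \in kmset -> op_far o A ->
  transfer_weight (op_transfer o A) < transfer_weight A.
Proof.
have leU B : B \in kmset -> mcard B <= k by rewrite in_kmset => /eqP ->.
move=> UA /andP[ok far]; rewrite /op_transfer ok.
case: o ok far => [[i j] b] /andP[/= nij bij]; rewrite /transfer_far /= => far.
have sA : b <= A i by apply: leq_trans (ltnW far); apply: leq_addl.
have [ei ej ex] := transferE nij (leU _ UA) sA.
have [UT _] : transfer i j b A \in kmset /\ transfer i j b (transfer i j b A) = A.
  by case: (transfer_polarization b nij) => H _ _ _; apply: H.
have lin B : B \in kmset -> \sum_(x : 'I_m) x * B x < (m * k).+1.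
  rewrite in_kmset => /eqP cB; rewrite ltnS.
  apply: leq_trans (_ : m * mcard B <= _); last by rewrite cB.
  rewrite /mcard big_distrr /=.
  by apply: leq_sum => x _; rewrite leq_mul2r ltnW ?orbT.
have exs (g : 'I_m -> nat -> nat) :
    \sum_(x | (x != i) && (x != j)) g x (transfer i j b A x) =
    \sum_(x | (x != i) && (x != j)) g x (A x).
  by apply: eq_bigr => x /andP[xi xj]; rewrite ex.
rewrite /transfer_weight; case: b bij far sA ei ej ex UT exs => /= bij far sA ei ej ex UT exs.
  have lt2 : \sum_x transfer i j true A x * transfer i j true A x < \sum_x A x * A x.
    rewrite !(sum_pair _ nij) (exs (fun _ c => c * c)) ltn_add2r ei ej.
    move: far; move: (nat_of_ord (A i)) (nat_of_ord (A j)) => a c /= far.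
    have [d ->] : exists d, a = c + 2 + d by exists (a - (c + 2)); lia.
    rewrite (_ : c + 2 + d - 1 = c + 1 + d); last lia.
    nia.
  exact: lex_ltn lt2 (lin _ UT).
rewrite !(sum_pair _ nij) (exs (fun _ c => c * c)) (exs (fun x c => x * c)) ei ej.
rewrite addn0 subn0 [A j * A j + _]addnC ltn_add2l ltn_add2r.
move: far bij; rewrite addn0.
move: (nat_of_ord (A i)) (nat_of_ord (A j)) (nat_of_ord i) (nat_of_ord j) => a c p q lt1 lt2.
have [d ->] : exists d, a = c.+1 + d by exists (a - c.+1); lia.
have [d' ->] : exists d', p = q.+1 + d' by exists (p - q.+1); lia.
nia.
Qed.

Lemma card_msupp_setI_le A B : #|msupp A :&: msupp B| <= mcap A B.
Proof.
rewrite -sum1_card big_mkcond /= leq_sum // => x _.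
by rewrite inE !in_msupp; case: ifP => // /andP[]; lia.
Qed.

(* If the supports of A and B meet in fewer than t elements, some i has
   multiplicity at least 2 in both, and m >= 2k - t leaves a j outside both
   supports; transferring from i to j in A lowers |A cap B| and keeps the
   intersection of the supports. *)
Lemma msupp_intersecting t F : 2 * k <= m + t -> int_family mcap kmset t F ->
  (forall i j A, i != j -> A \in F -> transfer_far i j 1 A -> transfer i j 1 A \in F) ->
  forall A B, A \in F -> B \in F -> t <= #|msupp A :&: msupp B|.
Proof.
move=> ktm [/subsetP FU iF] st A B.
have [d ltd] := ubnP (mcap A B); elim: d A ltd => // d IH A; rewrite ltnS => led FA FB.
rewrite leqNgt; apply/negP => small.
have tAB := iF _ _ FA FB.
have /existsP[i] : [exists i, 2 <= minn (A i) (B i)].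
  apply: contraT => /existsPn H.
  suff : mcap A B <= #|msupp A :&: msupp B| by lia.
  rewrite -sum1_card [X in _ <= X]big_mkcond /= leq_sum // => x _.
  by rewrite inE !in_msupp; have := H x; case: ifP => [/andP[]|/negbT]; lia.
move=> geI.
have cA : mcard A = k by apply/eqP; rewrite -in_kmset FU.
have cB : mcard B = k by apply/eqP; rewrite -in_kmset FU.
have maxE : mcap A B + \sum_x maxn (A x) (B x) = 2 * k.
  transitivity (mcard A + mcard B); last by rewrite cA cB mul2n addnn.
  rewrite /mcap /mcard -!big_split /=.
  by apply: eq_bigr => x _; lia.
have leU : #|msupp A :|: msupp B| < \sum_x maxn (A x) (B x).
  rewrite -sum1_card big_mkcond /= (bigD1 i) //= [X in _ < X](bigD1 i) //=.
  rewrite -addSn leq_add //.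
    by rewrite inE !in_msupp; case: ifP; lia.
  apply: leq_sum => x _; rewrite inE !in_msupp; case: ifP; lia.
have /set0Pn[j] : ~: (msupp A :|: msupp B) != set0.
  rewrite -cards_eq0 -lt0n; have := cardsC (msupp A :|: msupp B); rewrite card_ord; mlia.
rewrite !inE negb_or -!leqNgt !leqn0 => /andP[/eqP jA /eqP jB].
have nij : i != j by apply: contraTneq geI => ->; lia.
have sA : 1 <= A i by lia.
have far : transfer_far i j 1 A by rewrite /transfer_far; lia.
have FA' := st _ _ _ nij FA far.
have [|ei ej ex] := transferE nij _ sA; first by rewrite cA.
have := fun lt => IH _ lt FA' FB.
have -> : msupp (transfer i j 1 A) :&: msupp B = msupp A :&: msupp B.
  apply/setP => x; rewrite !inE.
  case: (eqVneq x i) => [->|xi]; first by rewrite ei addn1 sA.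
  case: (eqVneq x j) => [->|xj]; first by rewrite jB ltnn !andbF.
  by rewrite ex.
move=> H; suff /H : mcap (transfer i j 1 A) B < d by rewrite leqNgt small.
apply: leq_trans led; rewrite mcap_transfer ?cA //.
rewrite /mcap (sum_pair _ nij) ltn_add2r; lia.
Qed.

End Multisets.

(** * Counting multisets by support *)

(* A set S is the support of as many k-multisets of [m] as it is the trace on
   [m] of k-subsets of [m + k - 1]. *)
Section SupportCount.
Variables (m k : nat).
Local Notation ms := {ffun 'I_m -> 'I_k.+1}.
Local Notation n := (m + k.-1).
Implicit Types (A : ms) (x y : 'I_m) (S : {set 'I_m}) (B : {set 'I_n}).

Definition mset_incr x A : ms := mset_fun k (fun y => A y + (y == x)).

Lemma mset_incrE x A y : mcard A < k -> mset_incr x A y = A y + (y == x) :> nat.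
Proof.
move=> ltk; rewrite mset_funE //.
have : A y <= mcard A by rewrite /mcard (bigD1 y) //= leq_addr.
by case: (y == x); lia.
Qed.

Lemma mcard_incr x A : mcard A < k -> mcard (mset_incr x A) = (mcard A).+1.
Proof.
move=> ltk; rewrite /mcard; under eq_bigr do rewrite mset_incrE //.
rewrite big_split /= -[in RHS]addn1; congr (_ + _).
by rewrite (bigD1 x) //= eqxx big1 // => y /negbTE ->.
Qed.

Lemma mset_incr_inj q x : q < k -> {in [pred A | mcard A == q] &, injective (mset_incr x)}.
Proof.
move=> qk A B /eqP cA /eqP cB e; apply: mset_fun_eq => y.
move/(congr1 (fun C : ms => nat_of_ord (C y))): e.
by rewrite !mset_incrE ?cA ?cB //; apply: addIn.
Qed.

(** The number of compositions of [q] into [s] positive parts, with the value 1 at q = s = 0. *)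
Definition composition_count (q s : nat) : nat :=
  if q is q'.+1 then (if s is s'.+1 then 'C(q', s') else 0) else (s == 0 : bool).

Lemma composition_countS q s :
  composition_count q.+1 s.+1 = composition_count q s + composition_count q s.+1.
Proof.
case: q => [|q] /=; first by rewrite bin0n addn0.
by case: s => [|s] //=; rewrite ?bin0 // binS addnC.
Qed.

Lemma msupp_eq0 A : (msupp A == set0) = (mcard A == 0).
Proof.
rewrite /mcard sum_nat_eq0; apply/eqP/forallP => [S0 x|H].
  by apply/implyP => _; move/setP/(_ x): S0; rewrite in_msupp inE; case: (nat_of_ord _).
by apply/setP => x; rewrite in_msupp inE; have /eqP -> := H x.
Qed.

(** Lower the multiplicity of a fixed [x] in [S] by one: the support becomes [S :\ x] or stays [S],
    which is Pascal's rule. *)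
Lemma card_msupp_fiber q S : q <= k ->
  #|[set A : ms | (mcard A == q) && (msupp A == S)]| = composition_count q #|S|.
Proof.
elim: q S => [|q IH] S qk.
  have [->|nS] := eqVneq S set0.
    rewrite cards0 /=; have c0 : mcard (mset_fun k (fun _ : 'I_m => 0)) = 0.
      by rewrite /mcard big1 // => x _; rewrite mset_funE.
    rewrite (_ : [set A : ms | _] = [set mset_fun k (fun=> 0)]) ?cards1 //.
    apply/setP => A; rewrite !inE msupp_eq0 andbb; apply/eqP/eqP => [cA|->//].
    apply: mset_fun_eq => x; rewrite mset_funE //.
    by apply/eqP; move/eqP: cA; rewrite /mcard sum_nat_eq0 => /forallP/(_ x).
  rewrite /= cards_eq0 (negbTE nS); apply: eq_card0 => A; rewrite !inE -msupp_eq0.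
  by apply/negP => /andP[/eqP -> /eqP e]; rewrite e eqxx in nS.
have [->|/set0Pn[x xS]] := eqVneq S set0.
  rewrite cards0 /=; apply: eq_card0 => A; rewrite !inE msupp_eq0.
  by apply/negP => /andP[/eqP ->].
have cS : #|S| = #|S :\ x|.+1 by rewrite (cardsD1 x S) xS.
rewrite cS composition_countS -cS -!IH ?(ltnW qk) // addnC -cardsUI.
rewrite (_ : _ :&: _ = set0) ?cards0 ?addn0; last first.
  apply/setP => A; rewrite !inE; apply/negP => /andP[/andP[_ /eqP ->] /andP[_ /eqP e]].
  by move/setP/(_ x): e; rewrite !inE xS eqxx.
rewrite -[RHS](@card_in_imset _ _ (mset_incr x)); last first.
  move=> A B HA HB; apply: (mset_incr_inj qk); rewrite inE.
    by move: HA; rewrite !inE => /orP[] /andP[].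
  by move: HB; rewrite !inE => /orP[] /andP[].
apply: eq_card => A; rewrite inE; apply/andP/imsetP => [[/eqP cA /eqP sA]|].
  pose A' : ms := mset_fun k (fun y => A y - (y == x)).
  have eA' y : A' y = A y - (y == x) :> nat.
    by rewrite mset_funE // (leq_trans (leq_subr _ _)) // -ltnS.
  have Ax : 0 < A x by rewrite -in_msupp sA.
  have cA' : mcard A' = q.
    apply: succn_inj; rewrite -cA /mcard (bigD1 x) //= [RHS](bigD1 x) //= eA' eqxx -addSn.
    congr (_ + _); first by rewrite subn1 prednK.
    by apply: eq_bigr => y /negbTE nyx; rewrite eA' nyx subn0.
  exists A'; last first.
    apply: mset_fun_eq => y; rewrite mset_incrE ?cA' // eA'.
    by case: (eqVneq y x) => [->|_]; [rewrite subnK|rewrite subn0 addn0].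
  rewrite !inE cA' eqxx /= -orbC.
  case: (leqP (A x) 1) => Ax1.
    apply/orP; left; apply/eqP/setP => y; rewrite !inE eA' -sA in_msupp.
    by case: (eqVneq y x) => [->|_] /=; [rewrite subn_gt0 ltnNge Ax1|rewrite subn0].
  apply/orP; right; apply/eqP/setP => y; rewrite !inE eA' -sA in_msupp.
  by case: (eqVneq y x) => [->|_] /=; [rewrite subn_gt0 Ax1 Ax|rewrite subn0].
case=> A' HA' ->; have cA' : mcard A' = q by move: HA'; rewrite !inE => /orP[] /andP[/eqP].
rewrite mcard_incr ?cA' //; split=> //; apply/eqP/setP => y.
rewrite in_msupp mset_incrE ?cA' //.
move: HA'; rewrite !inE => /orP[] /andP[_ /eqP e]; move/setP/(_ y): e; rewrite in_msupp ?inE.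
  by case: (eqVneq y x) => [->|] /=; rewrite ?xS ?addn1 ?addn0.
by case: (eqVneq y x) => [->|] /=; rewrite ?xS ?addn1 ?addn0.
Qed.

Definition restrict B : {set 'I_m} := [set x | lshift k.-1 x \in B].

Lemma in_restrict B x : (x \in restrict B) = (lshift k.-1 x \in B).
Proof. by rewrite inE. Qed.

Definition glue S (C : {set 'I_k.-1}) : {set 'I_n} :=
  lshift k.-1 @: S :|: @rshift m k.-1 @: C.

Lemma in_glue_lshift S C x : (lshift k.-1 x \in glue S C) = (x \in S).
Proof.
rewrite inE mem_imset; last exact: lshift_inj.
rewrite [X in _ || X](_ : _ = false) ?orbF //.
by apply/imsetP => -[y _ /eqP]; rewrite eq_lrshift.
Qed.

Lemma in_glue_rshift S C (z : 'I_k.-1) : (rshift m z \in glue S C) = (z \in C).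
Proof.
rewrite inE orbC mem_imset; last exact: rshift_inj.
rewrite [X in _ || X](_ : _ = false) ?orbF //.
by apply/imsetP => -[y _ /eqP]; rewrite eq_rlshift.
Qed.

Lemma restrict_glue S C : restrict (glue S C) = S.
Proof. by apply/setP => x; rewrite in_restrict in_glue_lshift. Qed.

Lemma card_glue S C : #|glue S C| = #|S| + #|C|.
Proof.
rewrite cardsU (_ : _ :&: _ = set0) ?cards0 ?subn0.
  by rewrite !card_imset //; [exact: rshift_inj|exact: lshift_inj].
apply/setP => x; rewrite !inE; apply/negP => /andP[/imsetP[y _ ->] /imsetP[z _ /eqP]].
by rewrite eq_lrshift.
Qed.

Lemma glueK B : glue (restrict B) [set z : 'I_k.-1 | rshift m z \in B] = B.
Proof.
apply/setP => x; case: (split_ordP x) => y ->.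
  by rewrite in_glue_lshift in_restrict.
by rewrite in_glue_rshift inE.
Qed.

Lemma card_restrict_le B : #|restrict B| <= #|B|.
Proof. by rewrite -{2}[B]glueK card_glue leq_addr. Qed.

(** A [k]-set with trace [S] is completed by k - |S| of the k - 1 extra points, and C(k - 1, k -
    |S|) = C(k - 1, |S| - 1) is the number of compositions. *)
Lemma card_restrict_fiber S : 0 < k ->
  #|[set B : {set 'I_n} | (#|B| == k) && (restrict B == S)]| = composition_count k #|S|.
Proof.
move=> k0; case: (leqP #|S| k) => Sk; last first.
  rewrite (_ : composition_count _ _ = 0); last first.
    by move: Sk k0; case: k #|S| => [|q] [|s] //= lt _; rewrite bin_small.
  apply: eq_card0 => B; rewrite !inE; apply/negP => /andP[/eqP cB /eqP rB].
  by have := card_restrict_le B; rewrite rB cB leqNgt Sk.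
have -> : composition_count k #|S| = 'C(k.-1, k - #|S|).
  move: Sk k0; case: k #|S| => [|q] [|s] //= lt _; first by rewrite subn0 bin_small.
  by rewrite subSS bin_sub.
rewrite -[in RHS](card_ord k.-1) -card_draws -(@card_in_imset _ _ (glue S)); last first.
  move=> C C' _ _ e; apply/setP => x.
  by rewrite -(in_glue_rshift S) e in_glue_rshift.
apply: eq_card => B; rewrite inE; apply/andP/imsetP => [[/eqP cB /eqP rB]|[C]].
  exists [set z : 'I_k.-1 | rshift m z \in B]; last by rewrite -{1}[B]glueK rB.
  rewrite inE; apply/eqP; have := card_glue (restrict B) [set z : 'I_k.-1 | rshift m z \in B].
  by rewrite glueK cB rB; mlia.
by rewrite inE => /eqP cC ->; rewrite restrict_glue card_glue cC subnKC.
Qed.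

Lemma card_preim_fibers (T1 T2 : finType) (U : {set T1}) (f : T1 -> T2) (P : pred T2) :
  #|[set a in U | P (f a)]| = \sum_(b | P b) #|[set a in U | f a == b]|.
Proof.
rewrite -sum1_card (partition_big f P) /=; last by move=> a; rewrite inE => /andP[].
apply: eq_bigr => b Pb; rewrite -sum1_card; apply: eq_bigl => a; rewrite !inE.
by case: eqP => [->|]; rewrite ?Pb ?andbT ?andbF.
Qed.

Lemma card_msupp_restrict (P : pred {set 'I_m}) : 0 < k ->
  #|[set A in kmset m k | P (msupp A)]| =
  #|[set B : {set 'I_n} | (#|B| == k) && P (restrict B)]|.
Proof.
move=> k0; rewrite card_preim_fibers.
have -> : [set B : {set 'I_n} | (#|B| == k) && P (restrict B)] =
    [set B in [set B : {set 'I_n} | #|B| == k] | P (restrict B)].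
  by apply/setP => B; rewrite !inE.
rewrite card_preim_fibers; apply: eq_bigr => S _.
transitivity (composition_count k #|S|).
  rewrite -card_msupp_fiber //; apply: eq_card => A; by rewrite !inE.
by rewrite -card_restrict_fiber //; apply: eq_card => B; rewrite !inE.
Qed.

Lemma card_setI_restrict_segment B l : l <= m ->
  #|B :&: segment n l| = #|restrict B :&: segment m l|.
Proof.
move=> lm; rewrite -[RHS](card_imset _ (@lshift_inj m k.-1)).
apply: eq_card => x; rewrite !inE; apply/andP/imsetP => [[xB xl]|[y]].
  case: (split_ordP x) xB xl => y -> xB xl; first by exists y; rewrite // !inE xB.
  by move: xl; rewrite /= ltnNge (leq_trans lm) // leq_addr.
by rewrite !inE => /andP[yB yl] ->.
Qed.

End SupportCount.

(** * Undoing a transfer on an extremal family *)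

(** Each pair {[A], [rho A]} keeps its number of members in the shift and prefers the near one.
    Membership in [F] can thus be read off from [K], except when exactly one of the two belongs to
    it. *)
Lemma shift_cases (T : finType) (I : T -> T -> nat) (U : {set T}) far rho
    (F K : {set T}) A :
  polarization I U far rho -> F \subset U -> shift far rho F = K -> A \in U ->
  [/\ far A -> (A \in K) = (A \in F) && (rho A \in F),
      far A -> (rho A \in K) = (A \in F) || (rho A \in F) &
      ~~ far A -> ~~ far (rho A) -> (A \in K) = (A \in F)].
Proof.
move=> pol FU <- UA; have [rhoU fr _ _] := pol; have [UrA rrA] := rhoU _ UA.
split=> [fA|fA|nfA nfrA].
- by rewrite (in_shift pol FU UA) fA.
- by rewrite (in_shift pol FU UrA) (negbTE (fr _ UA fA)) rrA fA orbC.
- by rewrite (in_shift pol FU UA) (negbTE nfA) (negbTE nfrA) orbF.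
Qed.

Lemma shift_fixed (T : finType) (far : pred T) rho (F : {set T}) :
  (forall A, A \in F -> far A -> rho A \in F) -> shift far rho F = F.
Proof.
move=> st; rewrite /shift -[RHS]imset_id; apply: eq_in_imset => A FA.
by rewrite /shift_elt; case: ifP => // /andP[/(st _ FA) ->].
Qed.

Section Uniqueness.
Variables (m k t : nat).
Local Notation ms := {ffun 'I_m -> 'I_k.+1}.
Implicit Types (A B T : ms) (i j x y : 'I_m) (s r : nat) (F : {set ms}).
Implicit Types (C X : {set 'I_m}).

Definition mset_star T : {set ms} := [set A in kmset m k | [forall x, T x <= A x]].

(** Only the support enters, because the points of [X] have multiplicity one in the intersection
    that defines the family. *)
Definition mset_frankl r X : {set ms} :=
  [set A in kmset m k | t + r <= #|msupp A :&: X|].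

Definition mset_optimal F := int_family (@mcap m k) (kmset m k) t F /\
  forall F', int_family (@mcap m k) (kmset m k) t F' -> #|F'| <= #|F|.

Lemma kmset_card A : A \in kmset m k -> mcard A = k.
Proof. by rewrite in_kmset => /eqP. Qed.

Lemma mset_starP T A : A \in kmset m k ->
  reflect (forall x, T x <= A x) (A \in mset_star T).
Proof. by move=> UA; rewrite inE UA; apply: forallP. Qed.

Lemma in_mset_frankl r X A : A \in kmset m k ->
  (A \in mset_frankl r X) = (t + r <= #|msupp A :&: X|).
Proof. by rewrite [A \in mset_frankl r X]inE => ->. Qed.

Lemma mset_star_family T : mcard T = t ->
  int_family (@mcap m k) (kmset m k) t (mset_star T).
Proof.
move=> <-; split; first by apply/subsetP => A; rewrite inE => /andP[].
move=> A B; rewrite !inE => /andP[_ /forallP hA] /andP[_ /forallP hB].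
by apply: leq_sum => x _; rewrite leq_min hA hB.
Qed.

Lemma mset_frankl_family r X : #|X| = t + 2 * r ->
  int_family (@mcap m k) (kmset m k) t (mset_frankl r X).
Proof.
move=> cX; split; first by apply/subsetP => A; rewrite inE => /andP[].
move=> A B; rewrite !inE => /andP[_ hA] /andP[_ hB].
apply: leq_trans (card_msupp_setI_le A B).
have := cardsUI (msupp A :&: X) (msupp B :&: X).
have : #|msupp A :&: X :|: msupp B :&: X| <= #|X|.
  by rewrite subset_leq_card // subUset !subsetIr.
have : #|(msupp A :&: X) :&: (msupp B :&: X)| <= #|msupp A :&: msupp B|.
  by rewrite setIACA setIid subset_leq_card // subsetIl.
mlia.
Qed.

Lemma mset_optimal_eq F (K : {set ms}) : mset_optimal F -> F \subset K ->
  int_family (@mcap m k) (kmset m k) t K -> F = K.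
Proof. by move=> [_ maxF] FK famK; apply/eqP; rewrite eqEcard FK maxF. Qed.

(** A test multiset: each point of [C] once and all remaining copies on [y]. A multiset avoiding [y]
    meets it only in the points of [C], when [y] is not in [C]. *)
Definition pile (C : {set 'I_m}) y : ms :=
  mset_fun k (fun x => if x == y then k - #|C| else x \in C).

Lemma pileE C y x : #|C| < k ->
  pile C y x = (if x == y then k - #|C| else x \in C) :> nat.
Proof.
move=> Ck; rewrite mset_funE //; case: ifP => _; first exact: leq_subr.
by case: (_ \in _); lia.
Qed.

Lemma msupp_pile C y : #|C| < k -> msupp (pile C y) = y |: C.
Proof.
move=> Ck; apply/setP => x; rewrite in_msupp pileE // !inE.
by case: (x == y); [rewrite subn_gt0|case: (x \in C)].
Qed.

Lemma mcap_pile A C y : #|C| < k -> y \notin C ->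
  mcap A (pile C y) = minn (A y) (k - #|C|) + #|msupp A :&: C|.
Proof.
move=> Ck yC; rewrite /mcap (bigD1 y) //= pileE // eqxx; congr (_ + _).
rewrite -sum1_card [RHS]big_mkcond /= [RHS](bigD1 y) //= inE (negbTE yC) andbF add0n.
apply: eq_bigr => x xy; rewrite pileE // (negbTE xy) inE in_msupp.
by case: (x \in C); rewrite ?andbF ?andbT ?minn0 //=; case: (nat_of_ord (A x)) => //= a; lia.
Qed.

Lemma pile_kmset C y : #|C| < k -> y \notin C -> pile C y \in kmset m k.
Proof.
move=> Ck yC; rewrite in_kmset /mcard (bigD1 y) //= pileE // eqxx.
rewrite (eq_bigr (fun x => nat_of_bool (x \in C))); last first.
  by move=> x xy; rewrite pileE // (negbTE xy).
have -> : \sum_(x | x != y) (x \in C) = #|C|.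
  rewrite -sum1_card [RHS]big_mkcond /= [RHS](bigD1 y) //= (negbTE yC) add0n.
  by apply: eq_bigr => x _; case: (x \in C).
by apply/eqP; mlia.
Qed.

Section Transfer.
Variables (i j : 'I_m) (s : nat) (F : {set ms}).
Hypotheses (nij : i != j) (optF : mset_optimal F).
Local Notation far := (@transfer_far m k i j s).
Local Notation rho := (@transfer m k i j s).

(* Call A ambiguous if the image of A, but not A, contains T.  An ambiguous A
   and the image of any ambiguous B meet in fewer than t elements as soon as A
   or B is the preimage P0 of T with all k - t extra copies at j.  So as soon as
   one ambiguous multiset belongs to F all of them do, and F is the star of the
   transferred T. *)
Lemma star_shift_unique T : t <= k -> mcard T = t ->
  shift far rho F = mset_star T ->
  exists2 T', mcard T' = t & F = mset_star T'.
Proof.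
move=> tk cT eK; have pol := transfer_polarization k s nij.
have [[FU iF] maxF] := optF; have [rhoU fr iso mono] := pol.
case: (boolP [exists A in F, far A && (rho A \notin F)]) => [|/existsPn noA]; last first.
  exists T => //; rewrite -eK shift_fixed // => A FA fA.
  by have := noA A; rewrite FA fA /= negbK.
case/existsP => A0 /and3P[FA0 far0 nF0].
have FinU A : A \in F -> A \in kmset m k by apply: (subsetP FU).
have cases A := shift_cases pol FU eK (A := A).
have far_s A : far A -> s <= A i.
  by rewrite /transfer_far => fA; apply: leq_trans (ltnW fA); apply: leq_addl.
have leU A : A \in kmset m k -> mcard A <= k by move/kmset_card ->.
pose amb A := [&& A \in kmset m k, far A, A \notin mset_star T & rho A \in mset_star T].
have ambP A : amb A -> [/\ A j < T j, T i <= A j + s, T j <= A i - s &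
    forall x, x != i -> x != j -> T x <= A x].
  case/and4P => UA fA nKA KrA; have [UrA _] := rhoU _ UA.
  have [ei ej ex] := transferE nij (leU _ UA) (far_s _ fA).
  have H : forall x, T x <= rho A x by apply/mset_starP.
  have Hx x : x != i -> x != j -> T x <= A x by move=> xi xj; rewrite -ex.
  have Hi : T i <= A j + s by rewrite -ei.
  have Hj : T j <= A i - s by rewrite -ej.
  split=> //; rewrite ltnNge; apply: contra nKA => TjA.
  apply/mset_starP => // x; case: (eqVneq x i) => [->|xi].
    by apply: leq_trans Hi _; apply: ltnW.
  by case: (eqVneq x j) => [->//|xj]; apply: Hx.
have amb_moved A : A \in F -> far A -> rho A \notin F -> amb A.
  move=> FA fA nFA; have [ca cb _] := cases _ (FinU _ FA).
  by rewrite /amb fA FinU // ca // cb // FA (negbTE nFA).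
have [Tj0 Ti0 Tj0' _] := ambP _ (amb_moved _ FA0 far0 nF0).
pose B0 : ms := mset_fun k (fun x => T x + (x == j) * (k - t)).
have Tt x : T x <= t by rewrite -cT /mcard (bigD1 x) //= leq_addr.
have B0E x : B0 x = T x + (x == j) * (k - t) :> nat.
  by rewrite mset_funE //; have := Tt x; case: (x == j); lia.
have B0j : B0 j = T j + (k - t) :> nat by rewrite B0E eqxx mul1n.
have B0x x : x != j -> B0 x = T x :> nat by rewrite B0E => /negbTE ->; rewrite addn0.
have cB0 : mcard B0 = k.
  rewrite /mcard (sum_pair _ nij) B0j (B0x _ nij).
  under eq_bigr => x /andP[_ xj] do rewrite B0x //.
  by move: cT tk; rewrite /mcard (sum_pair _ nij); clear; olia.
have UB0 : B0 \in kmset m k by rewrite in_kmset cB0.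
have KB0 : B0 \in mset_star T by apply/mset_starP => // x; rewrite B0E leq_addr.
have capB0 A : amb A -> mcap A B0 < t.
  move=> /ambP[lt _ _ _]; rewrite /mcap (sum_pair _ nij).
  have le : \sum_(x | (x != i) && (x != j)) minn (A x) (B0 x)
      <= \sum_(x | (x != i) && (x != j)) T x.
    by apply: leq_sum => x /andP[_ xj]; rewrite B0x // geq_minr.
  by move: cT le lt; rewrite /mcard (sum_pair _ nij) (B0x _ nij); clear; olia.
have nFB0 : B0 \notin F.
  by apply/negP => FB0; have := iF _ _ FA0 FB0; rewrite leqNgt capB0 // amb_moved.
(* Otherwise [rho] fixes [B0], and [B0], being in the star, would lie in [F]. *)
have sT : s <= T i.
  rewrite leqNgt; apply/negP => lt.
  have rB0 : rho B0 = B0 by rewrite transfer_id // B0x.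
  have nfB0 : ~~ far B0.
    by rewrite /transfer_far -leqNgt B0x // (leq_trans (ltnW lt)) ?leq_addl.
  have [_ _ cc] := cases _ UB0.
  by move: nFB0; rewrite -cc ?rB0 // KB0.
pose P0 := rho B0.
have sB0 : s <= B0 i by rewrite B0x.
have [P0i P0j _] := transferE nij (leU _ UB0) sB0.
have [UP0 rP0] := rhoU _ UB0.
have farP0 : far P0 by rewrite /transfer_far P0i P0j B0x // B0j; move: Ti0 Tj0 sT; clear; olia.
have FP0 : P0 \in F.
  have [_ cb _] := cases _ UP0; move: (cb farP0).
  by rewrite rP0 KB0 (negbTE nFB0) orbF.
(* [rho A] meets [P0] in as many elements as [A] meets [rho P0 = B0], fewer than [t]. *)
have ambF A : amb A -> rho A \notin F.
  move=> aA; apply/negP => FrA; have /and4P[UA fA _ _] := aA.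
  have [_ e] := iso _ _ UA UP0 fA farP0.
  by have := iF _ _ FrA FP0; rewrite e rP0 leqNgt capB0.
have cTk : mcard T <= k by rewrite cT.
have [T'i T'j T'x] := transferE nij cTk sT.
have cT' : mcard (rho T) = t by rewrite mcard_transfer ?cT.
exists (rho T) => //; apply: (mset_optimal_eq optF); last exact: mset_star_family.
apply/subsetP => A FA; have UA := FinU _ FA; apply/mset_starP => //.
suff [hi hj hx] : [/\ T j + s <= A i, T i - s <= A j &
    forall x, x != i -> x != j -> T x <= A x].
  move=> x; case: (eqVneq x i) => [->|xi]; first by rewrite T'i.
  case: (eqVneq x j) => [->|xj]; first by rewrite T'j.
  by rewrite T'x // hx.
have [ca cb cc] := cases _ UA.
case: (boolP (far A)) => [fA|nfA].
  case: (boolP (rho A \in F)) => [FrA|nFrA].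
    have /mset_starP-/(_ UA) H : A \in mset_star T by rewrite ca // FA.
    have := H i; have := H j; move: fA; rewrite /transfer_far => fA hj hi.
    split=> [||x _ _]; last exact: H.
      by move: fA hj; clear; olia.
    by move: hj Ti0 Tj0; clear; olia.
  have [h1 h2 h3 h4] := ambP _ (amb_moved _ FA fA nFrA).
  split=> //; last by move: h2; clear; olia.
  by have := far_s _ fA; move: h3; clear; olia.
case: (leqP s (A i)) => sA; last first.
  have rA : rho A = A by rewrite transfer_id.
  have /mset_starP-/(_ UA) H : A \in mset_star T by rewrite cc ?rA.
  by have := H i; move: sT sA; clear; olia.
have [ei ej ex] := transferE nij (leU _ UA) sA.
have KA : A \in mset_star T /\ (far (rho A) -> T j <= A i - s).
  case: (boolP (far (rho A))) => [frA|nfrA]; last by rewrite cc.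
  have [UrA rrA] := rhoU _ UA; have [ca' cb' _] := cases _ UrA.
  have KA : A \in mset_star T by rewrite -rrA cb' // rrA FA orbT.
  split=> // _; case: (boolP (rho A \in mset_star T)) => [/mset_starP-/(_ UrA)/(_ j)|nK].
    by rewrite ej.
  have /ambF : amb (rho A) by rewrite /amb UrA frA nK rrA.
  by rewrite rrA FA.
case: KA => /mset_starP-/(_ UA) H K2.
have := H i; have := H j; move: nfA K2; rewrite /transfer_far ei ej -leqNgt => nfA K2 hj hi.
split=> [||x _ _]; last exact: H.
  by case: (ltnP (A i - s + s) (A j + s)) K2 => [_ /(_ isT)|]; move: sA hj; clear; olia.
by move: hj Ti0 Tj0; clear; olia.
Qed.

(* The analogue of [star_shift_unique], the special ambiguous multisets being
   the piles on i over a subset C of W.  For s = 1 a pile on j rules out that an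
   ambiguous multiset belongs to F.  For s = 0 any two such C are linked by
   single swaps, and C and its swap have a common D that meets both of them in
   t - 1 elements, which needs t > 1 (connectedness of a Kneser graph). *)
Lemma frankl_shift_unique r X : 0 < r -> 1 < t -> t + r <= k -> s <= 1 ->
  #|X| = t + 2 * r -> shift far rho F = mset_frankl r X ->
  exists2 X' : {set 'I_m}, #|X'| = t + 2 * r & F = mset_frankl r X'.
Proof.
move=> r0 t1 trk s1 cX eK; have pol := transfer_polarization k s nij.
have [[FU iF] maxF] := optF; have [rhoU fr iso mono] := pol.
case: (boolP [exists A in F, far A && (rho A \notin F)]) => [|/existsPn noA]; last first.
  exists X => //; rewrite -eK shift_fixed // => A FA fA.
  by have := noA A; rewrite FA fA /= negbK.
case/existsP => A0 /and3P[FA0 far0 nF0].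
have FinU A : A \in F -> A \in kmset m k by apply: (subsetP FU).
have cases A := shift_cases pol FU eK (A := A).
have far_s A : far A -> s <= A i.
  by rewrite /transfer_far => fA; apply: leq_trans (ltnW fA); apply: leq_addl.
have leU A : A \in kmset m k -> mcard A <= k by move/kmset_card ->.
pose amb A :=
  [&& A \in kmset m k, far A, A \notin mset_frankl r X & rho A \in mset_frankl r X].
have far_i A : far A -> i \in msupp A.
  by rewrite /transfer_far in_msupp => fA; apply: leq_ltn_trans fA.
have ambP A : amb A -> [/\ A j = 0 :> nat, j \in X, #|msupp A :&: X|.+1 = t + r,
    i \in msupp A & (s == 0) ==> (i \notin X)].
  case/and4P => UA fA; have [UrA _] := rhoU _ UA.
  have [ei ej ex] := transferE nij (leU _ UA) (far_s _ fA).
  rewrite !in_mset_frankl // -ltnNge => lt ge.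
  have iA := far_i _ fA.
  have sj : j \in msupp (rho A).
    by rewrite in_msupp ej subn_gt0; move: fA; rewrite /transfer_far; clear; olia.
  have sx x : x != i -> x != j -> (x \in msupp (rho A)) = (x \in msupp A).
    by move=> xi xj; rewrite !in_msupp ex.
  have Aj : A j = 0 :> nat.
    apply/eqP; rewrite -leqn0 leqNgt; apply/negP => Aj.
    suff e : msupp (rho A) = msupp A by move: ge; rewrite e leqNgt lt.
    apply/setP => x; case: (eqVneq x j) => [->|xj]; first by rewrite sj in_msupp Aj.
    case: (eqVneq x i) => [->|xi]; last exact: sx.
    by rewrite iA in_msupp ei ltn_addr.
  have jA : j \notin msupp A by rewrite in_msupp Aj.
  case: (posnP s) => [s0|s0].
    have e : msupp (rho A) = swap (msupp A) i j.
      apply/setP => x; rewrite in_swap.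
      case: (eqVneq x j) => [->|xj] //=; case: (eqVneq x i) => [->|xi] /=; last exact: sx.
      by rewrite in_msupp ei Aj s0.
    have := card_swapI X iA jA; rewrite -e => c.
    move: c lt ge iA; case: (i \in X); case: (j \in X) => /= c lt ge iA;
      split=> //; rewrite ?implybT //; mlia.
  have e : msupp (rho A) = j |: msupp A.
    apply/setP => x; rewrite in_setU1.
    case: (eqVneq x j) => [->|xj] //=; case: (eqVneq x i) => [->|xi] /=; last exact: sx.
    by rewrite iA in_msupp ei Aj.
  have c : #|msupp (rho A) :&: X| = #|msupp A :&: X| + (j \in X).
    rewrite e (cardsD1 j) inE setU11 /= addnC; congr (_ + _); apply: eq_card => x.
    by rewrite !inE; case: (eqVneq x j) => [->|] //=; rewrite Aj.
  move: c lt ge iA; case: (j \in X) => /= c lt ge iA; split=> //; mlia.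
have amb_moved A : A \in F -> far A -> rho A \notin F -> amb A.
  move=> FA fA nFA; have [ca cb _] := cases _ (FinU _ FA).
  by rewrite /amb fA FinU // ca // cb // FA (negbTE nFA).
have amb0 := amb_moved _ FA0 far0 nF0.
have [A0j jX cA0 iA0 isX] := ambP _ amb0.
pose W := X :\ j :\ i.
have iW : i \notin W by rewrite !inE eqxx.
have jW : j \notin W by rewrite !inE eqxx andbF.
have cW : #|W| + (i \in X) + 1 = t + 2 * r.
  rewrite -cX (cardsD1 j X) jX (cardsD1 i (X :\ j)) !inE nij /= /W; mlia.
have WX : W \subset X by rewrite (subset_trans (subD1set _ _)) // subD1set.
have cjWX C : C \subset W -> j |: C \subset X.
  by move=> CW; rewrite subUset sub1set jX (subset_trans CW).
(* With c = 1 if [i] is in [X] and 0 otherwise, [msupp A] has t + r - 1 - c points in [W], and |W| =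
   t + 2r - 1 - c. Hence the least overlap with a (t + r - 1)-subset of [W] is t - 1. *)
have neighbour A : amb A -> exists C : {set 'I_m},
    [/\ C \subset W, #|C|.+1 = t + r & #|msupp A :&: C| < t].
  move=> /ambP[Aj _ cA iA _]; have cAW : #|msupp A :&: W| + (i \in X) + 1 = t + r.
    rewrite -cA (cardsD1 i (msupp A :&: X)) inE iA /=.
    rewrite (_ : msupp A :&: W = (msupp A :&: X) :\ i); first by mlia.
    apply/setP => x; rewrite !inE; case: (eqVneq x j) => [->|] /=; last by rewrite andbCA.
    by rewrite Aj !andbF.
  have [|C CW [cC capC]] := @exists_min_intersection _ W (msupp A) (t + r).-1.
    by move: cW; case: (i \in X); mlia.
  exists C; split=> //; first by rewrite cC; mlia.
  by rewrite capC; move: cAW cW; case: (i \in X); mlia.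
have Ck C : #|C|.+1 = t + r -> #|C| < k by move=> ->.
have pileK C : C \subset W -> #|C|.+1 = t + r -> pile C j \in mset_frankl r X.
  move=> CW cC; have jC : j \notin C by apply: contraNN jW; apply: subsetP.
  rewrite in_mset_frankl ?pile_kmset ?msupp_pile ?Ck //.
  by rewrite (setIidPl (cjWX _ CW)) cardsU1 jC add1n cC.
case: (posnP s) => [s0|s0]; last first.
  have [C [CW cC capC]] := neighbour _ amb0.
  have jC : j \notin C by apply: contraNN jW; apply: subsetP.
  have iC : i \notin C by apply: contraNN iW; apply: subsetP.
  have Pi : pile C j i = 0 :> nat by rewrite pileE ?Ck // (negbTE nij) (negbTE iC).
  have UP : pile C j \in kmset m k by rewrite pile_kmset ?Ck.
  have nfP : ~~ far (pile C j) by rewrite /transfer_far Pi.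
  have rP : rho (pile C j) = pile C j by rewrite transfer_id ?Pi.
  have [_ _ cc] := cases _ UP.
  (* For s = 1 the transfer fixes this pile, which avoids [i], so it was in [F] from the start; it
     meets [A0] in fewer than [t] elements. *)
  have FP : pile C j \in F by rewrite -cc ?rP // pileK.
  have := iF _ _ FA0 FP; rewrite mcap_pile ?Ck // A0j min0n add0n.
  by rewrite leqNgt capC.
have iX : i \notin X by move: isX; rewrite s0.
have pureE C : C \subset W -> #|C|.+1 = t + r -> [/\ amb (pile C i), rho (pile C i) = pile C j
    & forall A, amb A -> #|msupp A :&: C| < t ->
      (A \in F) = (pile C i \in F) /\ ((A \in F) -> (rho A \notin F))].
  move=> CW cC; have jC : j \notin C by apply: contraNN jW; apply: subsetP.
  have iC : i \notin C by apply: contraNN iW; apply: subsetP.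
  have ck := Ck _ cC.
  have UP : pile C i \in kmset m k by rewrite pile_kmset.
  have Pj : pile C i j = 0 :> nat by rewrite pileE // eq_sym (negbTE nij) (negbTE jC).
  have Pi : pile C i i = k - #|C| :> nat by rewrite pileE // eqxx.
  have farP : far (pile C i) by rewrite /transfer_far Pi Pj s0 subn_gt0.
  have rP : rho (pile C i) = pile C j.
    have [ei ej ex] := transferE nij (leU _ UP) (far_s _ farP).
    apply: mset_fun_eq => x; rewrite (pileE _ _ ck).
    case: (eqVneq x j) => [->|xj]; first by rewrite ej Pi s0 subn0.
    case: (eqVneq x i) => [->|xi]; first by rewrite ei Pj s0 (negbTE iC).
    by rewrite ex // pileE // (negbTE xi).
  have aP : amb (pile C i).
    rewrite /amb UP farP rP pileK // andbT in_mset_frankl // msupp_pile // -ltnNge.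
    suff -> : (i |: C) :&: X = C by rewrite /= -cC.
    apply/setP => x; rewrite !inE.
    case: (eqVneq x i) => [->|_] /=; first by rewrite (negbTE iX) (negbTE iC).
    by case: (boolP (x \in C)) => //= xC; apply: (subsetP WX); apply: (subsetP CW).
  split=> // A aA capA; have [Aj _ _ _ _] := ambP _ aA.
  have capQ : mcap A (pile C j) < t by rewrite mcap_pile // Aj min0n.
  have /and4P[UA fA nKA KrA] := aA; have /and4P[_ _ nKP KrP] := aP.
  have [_ cbA _] := cases _ UA; have [_ cbP _] := cases _ UP.
  have PrA : pile C i \in F -> rho A \notin F.
    move=> FP; apply/negP => FrA; have [_ e] := iso _ _ UA UP fA farP.
    by have := iF _ _ FrA FP; rewrite e rP leqNgt capQ.
  have AP : A \in F -> pile C i \in F.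
    move=> FA; move: (cbP farP); rewrite KrP rP.
    case: (boolP (pile C j \in F)) => [FQ|_]; last by rewrite orbF.
    by have := iF _ _ FA FQ; rewrite leqNgt capQ.
  split; last by move/AP.
  apply/idP/idP => [//|FP]; move: (cbA fA); rewrite KrA (negbTE (PrA FP)).
  by rewrite orbF.
pose pure C := [&& C \subset W, #|C|.+1 == t + r & pile C i \in F].
have pure_closed : swap_closed W pure.
  move=> C x y /and3P[CW /eqP cC FC] xW yW xC yC.
  have cC' := card_swap xC yC.
  have C'W : swap C x y \subset W.
    by rewrite subUset sub1set yW (subset_trans _ CW) // subD1set.
  rewrite /pure C'W cC' cC eqxx /=.
  have nxy : x != y by apply: contraNneq yC => <-.
  pose W' := W :\ x :\ y.
  have cW' : #|W'|.+2 = #|W|.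
    by rewrite (cardsD1 x W) xW (cardsD1 y (W :\ x)) in_setD1 eq_sym nxy yW.
  have cCW' : #|C :&: W'|.+1 = #|C|.
    rewrite (cardsD1 x C) xC add1n; congr _.+1; apply: eq_card => z; rewrite !inE.
    case: (boolP (z \in C)) => zC; rewrite ?andbF //=.
    have -> : z != y by apply: contraNneq yC => <-.
    by have := subsetP CW _ zC; rewrite !inE => ->; rewrite !andbT.
  rewrite (negbTE iX) in cW.
  (* Inside [W'], of size t + 2r - 3, [C] has t + r - 2 points, so [D'] can meet it in only t - 2.
     Adding [x] and [y] gives a [D] meeting both [C] and its swap in t - 1 points. *)
  have [|D' D'W [cD' capD']] := @exists_min_intersection _ W' C (t + r - 3); first by mlia.
  pose D := x |: (y |: D').
  have yD' : y \notin D' by apply/negP => /(subsetP D'W); rewrite !inE eqxx.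
  have xD' : x \notin y |: D'.
    by rewrite !inE negb_or nxy; apply/negP => /(subsetP D'W); rewrite !inE eqxx andbF.
  have cD : #|D|.+1 = t + r by rewrite !cardsU1 xD' yD' cD'; mlia.
  have DW : D \subset W.
    rewrite !subUset !sub1set xW yW (subset_trans D'W) //.
    by rewrite (subset_trans (subD1set _ _)) // subD1set.
  have iD : i \notin D by apply: contraNN iW; apply: subsetP.
  have capD : #|C :&: D| < t.
    have -> : C :&: D = x |: (C :&: D').
      apply/setP => z; rewrite !inE; case: (eqVneq z x) => [->|]; first by rewrite xC.
      by case: (eqVneq z y) => [->|] //=; rewrite (negbTE yC).
    have xCD : x \notin C :&: D'.
      by apply: contra xD'; rewrite !inE => /andP[_ ->]; rewrite orbT.
    by rewrite cardsU1 xCD; mlia.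
  have capD2 : #|swap C x y :&: D| < t.
    have := card_swapI D xC yC; rewrite !inE !eqxx orbT; mlia.
  have pcap (E : {set 'I_m}) : #|E|.+1 = t + r -> #|msupp (pile E i) :&: D| = #|E :&: D|.
    move=> cE; rewrite msupp_pile ?Ck //; apply: eq_card => z; rewrite !inE.
    by case: (eqVneq z i) => [->|] //=; move: iD; rewrite !inE => /negbTE ->; rewrite andbF.
  have cC2 : #|swap C x y|.+1 = t + r by rewrite cC'.
  have [_ _ linkD] := pureE _ DW cD.
  have [aC _ _] := pureE _ CW cC; have [aC' _ _] := pureE _ C'W cC2.
  have [|e1 _] := linkD _ aC; first by rewrite pcap.
  have [|e2 _] := linkD _ aC'; first by rewrite pcap.
  by rewrite e2 -e1.
have [C0 [C0W cC0 cap0]] := neighbour _ amb0.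
have pure0 : pure C0.
  have [_ _ /(_ _ amb0 cap0)[e _]] := pureE _ C0W cC0.
  by rewrite /pure C0W cC0 eqxx -e.
have ambF A : amb A -> rho A \notin F.
  move=> aA; have [C [CW cC capC]] := neighbour _ aA.
  have [_ _ /(_ _ aA capC)[e]] := pureE _ CW cC; apply; rewrite e.
  have /and3P[//] : pure C.
  apply: (swap_closed_exchange pure_closed pure0); last by apply: succn_inj; rewrite cC.
  have D0 (E : {set 'I_m}) : E \subset W -> E :\: W = set0.
    by move=> EW; apply/eqP; rewrite finset.setD_eq0.
  by rewrite !D0.
(* All ambiguous multisets have kept their place, so the family belongs to [X] with [j] replaced by
   [i]. *)
have cX' : #|swap X j i| = t + 2 * r by rewrite card_swap.
exists (swap X j i) => //; apply: (mset_optimal_eq optF); last exact: mset_frankl_family.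
apply/subsetP => A FA; have UA := FinU _ FA; rewrite in_mset_frankl //.
have := card_swapI (msupp A) jX iX; rewrite setIC [X :&: _]setIC => csw.
have [ca cb cc] := cases _ UA.
case: (boolP (far A)) => [fA|nfA].
  have iA := far_i _ fA; rewrite iA in csw.
  case: (boolP (rho A \in F)) => [FrA|nFrA].
    have : A \in mset_frankl r X by rewrite ca // FA.
    by rewrite in_mset_frankl //; move: csw; case: (j \in _) => /=; mlia.
  have [Aj _ cA _ _] := ambP _ (amb_moved _ FA fA nFrA).
  have jA : (j \in msupp A) = false by rewrite in_msupp Aj.
  by move: csw; rewrite jA; mlia.
have sA : s <= A i by rewrite s0.
have [UrA rrA] := rhoU _ UA.
have [ei ej ex] := transferE nij (leU _ UA) sA.
case: (boolP (far (rho A))) => [frA|nfrA]; last first.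
  have : A \in mset_frankl r X by rewrite cc.
  rewrite in_mset_frankl //.
  have eij : (i \in msupp A) = (j \in msupp A).
    rewrite !in_msupp; move: nfA nfrA; rewrite /transfer_far ei ej s0 !addn0 subn0 -!leqNgt.
    by move=> le1 le2; rewrite (_ : nat_of_ord (A i) = A j) //; apply/eqP; rewrite eqn_leq le1.
  by move: csw; rewrite eij => /addIn ->.
have [ca' cb' _] := cases _ UrA.
have KA : A \in mset_frankl r X by rewrite -rrA cb' // rrA FA orbT.
have KrA : rho A \in mset_frankl r X.
  apply: contraT => nK; have /ambF : amb (rho A) by rewrite /amb UrA frA nK rrA.
  by rewrite rrA FA.
rewrite !in_mset_frankl // in KA KrA.
have ltij : A i < A j by move: frA; rewrite /transfer_far ei ej s0 !addn0 subn0.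
have jA : j \in msupp A by rewrite in_msupp (leq_ltn_trans _ ltij).
rewrite jA in csw; case: (posnP (A i)) => Ai; last first.
  by rewrite in_msupp Ai in csw; mlia.
have iA : i \notin msupp A by rewrite in_msupp Ai.
have e : msupp (rho A) = swap (msupp A) j i.
  apply/setP => x; rewrite in_swap.
  case: (eqVneq x i) => [->|xi] /=.
    by rewrite in_msupp ei s0 addn0 (leq_ltn_trans _ ltij).
  case: (eqVneq x j) => [->|xj] /=; first by rewrite in_msupp ej Ai.
  by rewrite !in_msupp ex.
have := card_swapI X jA iA; rewrite -e jX (negbTE iX).
rewrite (negbTE iA) in csw; mlia.
Qed.
End Transfer.
End Uniqueness.

(** * From multisets to sets *)

Section Reduction.
Variables (m k t : nat).
Local Notation ms := {ffun 'I_m -> 'I_k.+1}.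
Local Notation n := (m + k.-1).
Implicit Types (A : ms) (B : {set 'I_n}) (F : {set ms}).
Local Notation mset_family := (int_family (@mcap m k) (kmset m k) t).

Definition stable F := forall o A, A \in F -> op_far o A -> op_transfer o A \in F.

Definition support_sets F : {set {set 'I_n}} :=
  [set B : {set 'I_n} | (#|B| == k) && (restrict B \in @msupp m k @: F)].

Definition support_closed F := F = [set A in kmset m k | msupp A \in @msupp m k @: F].

Lemma card_msupp_le A : #|msupp A| <= mcard A.
Proof.
have := card_msupp_setI_le A A; rewrite setIid => h; apply: leq_trans h _.
by apply: leq_sum => x _; rewrite minnn.
Qed.

Lemma card_restrict_setI_le B B' : #|restrict B :&: restrict B'| <= #|B :&: B'|.
Proof.
rewrite -(card_imset _ (@lshift_inj m k.-1)); apply: subset_leq_card.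
by apply/subsetP => _ /imsetP[x + ->]; rewrite !inE.
Qed.

Lemma sub_support_closure F : F \subset kmset m k ->
  F \subset [set A in kmset m k | msupp A \in @msupp m k @: F].
Proof. by move/subsetP => FU; apply/subsetP => A FA; rewrite inE FU // imset_f. Qed.

Lemma card_support_sets F : 0 < k ->
  #|[set A in kmset m k | msupp A \in @msupp m k @: F]| = #|support_sets F|.
Proof. by move=> k0; apply: (card_msupp_restrict (mem (@msupp m k @: F)) k0). Qed.

Section Stable.
Variable F : {set ms}.
Hypotheses (tk : 0 < t <= k) (ktm : 2 * k <= m + t).
Hypotheses (famF : mset_family F) (stF : stable F).

Lemma stable_msupp A A' : A \in F -> A' \in F -> t <= #|msupp A :&: msupp A'|.
Proof.
apply: msupp_intersecting => // i j B nij FB far.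
have ok : transfer_ok (i, j, true) by rewrite /transfer_ok /= nij.
have := @stF (i, j, true) B FB; rewrite /op_far /op_transfer ok /=; exact.
Qed.

Lemma restrict_support_sets B B' : B \in support_sets F -> B' \in support_sets F ->
  t <= #|restrict B :&: restrict B'|.
Proof.
rewrite !inE => /andP[_ /imsetP[A FA ->]] /andP[_ /imsetP[A' FA' ->]].
exact: stable_msupp.
Qed.

Lemma support_sets_family : set_family k t (support_sets F).
Proof.
split=> [B|B B' GB GB']; first by rewrite inE => /andP[/eqP].
by apply: leq_trans (card_restrict_setI_le B B'); apply: restrict_support_sets.
Qed.

(** For [j] and [i] both in [m], compression follows from stability under the exchange s = 0.
    Removing an extra point does not shrink the trace, so there the compressed set already meets all
    others in [t] points, and optimality puts it in the family. *)
Lemma support_sets_compressed :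
  set_optimal k t (support_sets F) -> compressed (support_sets F).
Proof.
move=> [_ maxG] B a b GB lt_ab bB aB; have /andP[t0 le_tk] := tk.
have cB : #|B| = k by move: GB; rewrite inE => /andP[/eqP].
have cB' : #|swap B b a| = k by rewrite card_swap.
case: (split_ordP b) => [y eb|y eb]; last first.
  apply: contraT => nG.
  have sub : restrict B \subset restrict (swap B b a).
    apply/subsetP => x; rewrite !in_restrict in_swap eb eq_lrshift /= => ->.
    by rewrite orbT.
  have capG B' : B' \in support_sets F -> t <= #|swap B b a :&: B'|.
    move=> GB'; apply: leq_trans (card_restrict_setI_le _ _).
    apply: leq_trans (restrict_support_sets GB GB') _.
    by rewrite subset_leq_card // setSI.
  have : set_family k t (swap B b a |: support_sets F).
    split=> [C|C C']; rewrite !in_setU1.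
      by case/orP => [/eqP -> //|]; rewrite inE => /andP[/eqP].
    case/orP => [/eqP ->|GC] /orP[/eqP ->|GC'].
    - by rewrite setIid cB'.
    - exact: capG.
    - by rewrite setIC capG.
    - by case: support_sets_family => _; apply.
  by move/maxG; rewrite cardsU1 nG add1n ltnn.
case: (split_ordP a) => [x ea|x ea]; last first.
  by move: lt_ab; rewrite ea eb /=; have := ltn_ord y; lia.
have lt_xy : x < y by move: lt_ab; rewrite ea eb.
move: GB; rewrite !inE cB' eqxx /= => /andP[_ /imsetP[A FA eA]].
have yA : y \in msupp A by rewrite -eA in_restrict -eb.
have xA : x \notin msupp A by rewrite -eA in_restrict -ea.
have nyx : y != x by rewrite -val_eqE /=; lia.
have ok : transfer_ok (y, x, false) by rewrite /transfer_ok /= nyx.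
have A0 : A x = 0 :> nat by apply/eqP; move: xA; rewrite in_msupp -leqNgt leqn0.
have Ay : 0 < A y by rewrite -in_msupp.
have far : op_far (y, x, false) A by rewrite /op_far ok /= /transfer_far A0.
have := stF FA far; rewrite /op_transfer ok /= => FA'.
have cA : mcard A <= k.
  by case: famF => /subsetP/(_ _ FA); rewrite in_kmset => /eqP ->.
have [ei ej ex] := transferE nyx cA (leq0n (A y)).
apply/imsetP; exists (transfer y x 0 A) => //; apply/setP => z.
rewrite in_restrict in_swap ea eb !(inj_eq (@lshift_inj m k.-1)) -in_restrict eA [RHS]in_msupp.
case: (eqVneq z x) => [->|zx] /=; first by rewrite ej subn0 Ay.
case: (eqVneq z y) => [->|zy] /=; first by rewrite ei A0.
by rewrite in_msupp ex.
Qed.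

End Stable.

Lemma mset_family_bound M : 0 < t <= k -> 2 * k <= m + t ->
  (forall G : {set {set 'I_n}}, set_family k t G -> #|G| <= M) ->
  forall F, mset_family F -> #|F| <= M.
Proof.
move=> tk ktm maxG; have k0 : 0 < k by case/andP: tk => ? ?; lia.
apply: (shift_ind (P := fun F => #|F| <= M)
          (@mcapC m k) (@op_polarization m k) (@op_weight m k)).
  move=> F famF stF; apply: leq_trans _ (maxG _ (support_sets_family ktm famF stF)).
  rewrite -card_support_sets //; apply: subset_leq_card.
  by apply: sub_support_closure; case: famF.
move=> F o A [FU _] _ _ _; by rewrite (card_shift (op_polarization k o)).
Qed.

(** In the stable case F, its support closure and [support_sets F] satisfy |F| <= |closure| =
    |support_sets F| <= M; equality makes [F] support-closed and the set family optimal. The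
    property [canonical] is abstract so as to serve both off and at the threshold. *)
Lemma mset_family_extremal M (canonical : {set ms} -> Prop) :
  0 < t <= k -> 2 * k <= m + t ->
  (forall G : {set {set 'I_n}}, set_family k t G -> #|G| <= M) ->
  (forall F, support_closed F -> set_optimal k t (support_sets F) ->
     compressed (support_sets F) -> canonical F) ->
  (forall F i j s, i != j -> s <= 1 -> mset_optimal t F ->
     canonical (shift (@transfer_far m k i j s) (@transfer m k i j s) F) ->
     canonical F) ->
  forall F, mset_family F -> #|F| = M -> canonical F.
Proof.
move=> tk ktm maxG Hst Hsh; have k0 : 0 < k by case/andP: tk => ? ?; lia.
have bound := mset_family_bound tk ktm maxG.
apply: (shift_ind (P := fun F => #|F| = M -> canonical F)
          (@mcapC m k) (@op_polarization m k) (@op_weight m k)).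
  move=> F famF stF cF; have famG := support_sets_family ktm famF stF.
  have subF := sub_support_closure (proj1 famF).
  have cG := card_support_sets F k0.
  have optG : set_optimal k t (support_sets F).
    by split=> // G' /maxG le; apply: leq_trans le _; rewrite -cG -cF subset_leq_card.
  apply: Hst => //; last exact: support_sets_compressed.
  by apply/eqP; rewrite eqEcard subF cG cF maxG.
move=> F [[i j] b] A famF FA far nFA IH cF.
have FU := proj1 famF.
move: IH; rewrite (card_shift (op_polarization k _)) // => /(_ cF).
have ok : transfer_ok (i, j, b) by case/andP: far.
have -> : shift (op_far (i, j, b)) (op_transfer (i, j, b)) F =
    shift (@transfer_far m k i j b) (@transfer m k i j b) F.
  by apply: eq_imset => A'; rewrite /shift_elt /op_far /op_transfer ok.
apply: Hsh; [by case/andP: ok|by case: (b)|].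
by split=> // F' /bound; rewrite cF.
Qed.

Lemma support_closed_frankl F r : 0 < k -> t + 2 * r <= m -> support_closed F ->
  support_sets F = set_frankl n k t r ->
  F = mset_frankl k t r (segment m (t + 2 * r)).
Proof.
move=> k0 le_m eF eG; apply/setP => A; rewrite [in LHS]eF !inE.
case: (boolP (mcard A == k)) => //= /eqP cA.
(* A nonempty support leaves at most k - 1 points to fill in, and there are k - 1 extra ones. *)
have S0 : 0 < #|msupp A| by rewrite card_gt0 msupp_eq0 cA -lt0n.
have Sk := card_msupp_le A; rewrite cA in Sk.
have [|C _ cC] := @exists_subset_card _ [set: 'I_k.-1] (k - #|msupp A|).
  by rewrite cardsT card_ord; mlia.
have cB : #|glue (msupp A) C| = k by rewrite card_glue cC subnKC.
move/setP/(_ (glue (msupp A) C)): eG.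
by rewrite !inE cB eqxx restrict_glue card_setI_restrict_segment // restrict_glue.
Qed.

Lemma card_mset_frankl r : 0 < k -> t + 2 * r <= m ->
  #|mset_frankl k t r (segment m (t + 2 * r))| = #|set_frankl n k t r|.
Proof.
move=> k0 le_m.
rewrite (card_msupp_restrict (fun S => t + r <= #|S :&: segment m (t + 2 * r)|) k0).
by apply: eq_card => B; rewrite !inE card_setI_restrict_segment.
Qed.

Lemma mset_frankl0_star : t <= m -> t <= k ->
  exists2 T : ms, mcard T = t & mset_frankl k t 0 (segment m (t + 2 * 0)) = mset_star T.
Proof.
move=> tm tk; case: (posnP k) => k0.
  exists (mset_fun k (fun=> 0)).
    by rewrite /mcard big1 => [|x _]; [lia|rewrite mset_funE].
  apply/setP => A; rewrite !inE; congr (_ && _).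
  rewrite (_ : t = 0) ?leq0n; last lia.
  by apply/esym/forallP => x; rewrite mset_funE.
pose T : ms := mset_fun k (fun x => x < t).
have TE x : T x = (x < t) :> nat by rewrite mset_funE //; case: (_ < _).
have cS : #|segment m (t + 2 * 0)| = t by rewrite card_segment ?muln0 ?addn0.
exists T.
  rewrite -[RHS]cS -sum1_card [RHS]big_mkcond /=; apply: eq_bigr => x _.
  by rewrite TE inE muln0 addn0; case: (_ < _).
apply/setP => A; rewrite !inE; congr (_ && _).
apply/idP/forallP => [le x|H].
  have /eqP e : segment m (t + 2 * 0) == msupp A :&: segment m (t + 2 * 0).
    by rewrite eq_sym eqEcard subsetIr cS -[X in X <= _]addn0.
  rewrite TE; case: (ltnP x t) => // lt.
  have : x \in segment m (t + 2 * 0) by rewrite inE muln0 addn0.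
  by rewrite e inE in_msupp => /andP[].
rewrite (_ : _ :&: _ = segment m (t + 2 * 0)) ?cS ?addn0 //.
apply/setIidPr/subsetP => x; rewrite in_msupp inE => lt.
by have := H x; rewrite TE lt.
Qed.

(** Replacing the sub-multiset [T1] by [T2] inside each member is injective. *)
Lemma card_mset_star (T T' : ms) : mcard T = t -> mcard T' = t ->
  #|mset_star T| = #|mset_star T'|.
Proof.
suff le (T1 T2 : ms) : mcard T1 = t -> mcard T2 = t -> #|mset_star T1| <= #|mset_star T2|.
  by move=> cT cT'; apply/eqP; rewrite eqn_leq !le.
move=> c1 c2; pose f A : ms := mset_fun k (fun x => A x - T1 x + T2 x).
have fE A x : A \in mset_star T1 -> f A x = A x - T1 x + T2 x :> nat.
  rewrite inE => /andP[UA /forallP H]; rewrite mset_funE //.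
  have : A x + \sum_(y | y != x) A y = k.
    by rewrite -[RHS](kmset_card UA) /mcard [RHS](bigD1 x).
  have : T2 x <= t by rewrite -c2 /mcard (bigD1 x) //= leq_addr.
  have : t <= T1 x + \sum_(y | y != x) A y.
    by rewrite -c1 /mcard (bigD1 x) //= leq_add2l leq_sum.
  by have := H x; move: (\sum_(y | y != x) _) => S; clear; olia.
rewrite -(card_in_imset (f := f) (D := mset_star T1)).
  apply: subset_leq_card; apply/subsetP => _ /imsetP[A KA ->].
  have /andP[UA /forallP H] : (A \in kmset m k) && [forall x, T1 x <= A x].
    by move: KA; rewrite inE.
  rewrite inE; apply/andP; split; last by apply/forallP => x; rewrite fE // leq_addl.
  rewrite in_kmset; apply/eqP; rewrite -[RHS](kmset_card UA) /mcard.
  under eq_bigr do rewrite fE //.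
  rewrite big_split /= -[X in _ + X]/(mcard T2) c2 -c1 /mcard -big_split /=.
  by apply: eq_bigr => x _; rewrite subnK.
move=> A A' KA KA' e; apply: mset_fun_eq => x.
move/(congr1 (fun C : ms => nat_of_ord (C x))): e; rewrite !fE //.
move: KA KA'; rewrite !inE => /andP[_ /forallP/(_ x) h] /andP[_ /forallP/(_ x) h'].
move: h h'; clear; olia.
Qed.

End Reduction.

(** * Bounds and equality cases for multisets as finite functions *)

Section MultisetIntersection.
Variables (m k t : nat).
Local Notation ms := {ffun 'I_m -> 'I_k.+1}.
Local Notation n := (m + k.-1).
Implicit Types (A B : ms) (F : {set ms}).
Local Notation mset_family := (int_family (@mcap m k) (kmset m k) t).

Definition is_mset_frankl r F :=
  exists2 X : {set 'I_m}, #|X| = t + 2 * r & F = mset_frankl k t r X.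

Definition is_mset_star F := exists2 T : ms, mcard T = t & F = mset_star T.

Definition initial_frankl r := @mset_frankl m k t r (segment m (t + 2 * r)).

Lemma mset_intersection_strict r : 0 < t <= k -> r <= k - t -> 2 * k <= m + t ->
  (k - t + 1) * (t + 2 * r + 1) < r.+1 * n ->
  (0 < r -> r * n < (k - t + 1) * (t + 2 * r - 1)) ->
  forall F, mset_family F -> #|F| <= #|initial_frankl r| /\
    (#|F| = #|initial_frankl r| ->
       (0 < r -> is_mset_frankl r F) /\ (r = 0 -> is_mset_star F)).
Proof.
move=> tk rkt ktm lower upper F famF; have /andP[t0 le_tk] := tk.
have k0 : 0 < k by lia.
have le_m : t + 2 * r <= m by lia.
have [uniq bound] := complete_intersection_strict tk rkt lower upper.
rewrite /initial_frankl card_mset_frankl //; split.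
  exact: (mset_family_bound tk ktm bound).
move: F famF.
apply: (mset_family_extremal
  (canonical := fun F => (0 < r -> is_mset_frankl r F) /\ (r = 0 -> is_mset_star F))
  tk ktm bound).
  move=> F clF optG cG.
  have eF := support_closed_frankl k0 le_m clF (uniq _ optG cG).
  split=> [_|r0]; first by exists (segment m (t + 2 * r)); rewrite ?card_segment.
  have [|T cT eT] := @mset_frankl0_star m k t _ le_tk; first by lia.
  by exists T; rewrite // eF r0.
move=> F i j s nij s1 optF [IH1 IH0]; split=> [r0|r0].
  have [X cX eX] := IH1 r0.
  apply: (frankl_shift_unique nij optF) s1 cX eX => //; last by lia.
  by apply: set_frankl_gt1 lower _ => //; apply: upper.
by have [T cT eT] := IH0 r0; apply: (star_shift_unique nij optF) cT eT.
Qed.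

Lemma mset_intersection_boundary_gt1 r : 1 < t <= k -> r < k - t -> 2 * k <= m + t ->
  r.+1 * n = (k - t + 1) * (t + 2 * r + 1) ->
  forall F, mset_family F -> #|F| <= #|initial_frankl r| /\
    (#|F| = #|initial_frankl r| ->
       [\/ 0 < r /\ is_mset_frankl r F, r = 0 /\ is_mset_star F | is_mset_frankl r.+1 F]).
Proof.
move=> /andP[t1 le_tk] rkt ktm eqn F famF; have tk : 0 < t <= k by lia.
have k0 : 0 < k by lia.
have le_m : t + 2 * r <= m by lia.
have le_m1 : t + 2 * r.+1 <= m by lia.
have [|uniq bound eqM] := complete_intersection_boundary _ rkt eqn; first by rewrite t1.
rewrite /initial_frankl card_mset_frankl //; split.
  exact: (mset_family_bound tk ktm bound).
move: F famF.
apply: (mset_family_extremal (canonical := fun F => [\/ 0 < r /\ is_mset_frankl r F,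
   r = 0 /\ is_mset_star F | is_mset_frankl r.+1 F]) tk ktm bound).
  move=> F clF optG cG; case: (uniq _ optG cG) => eG; last first.
    have eF := support_closed_frankl k0 le_m1 clF eG.
    by apply: Or33; exists (segment m (t + 2 * r.+1)); rewrite ?card_segment.
  have eF := support_closed_frankl k0 le_m clF eG.
  case: (posnP r) => r0; last first.
    by apply: Or31; split=> //; exists (segment m (t + 2 * r)); rewrite ?card_segment.
  apply: Or32; split=> //.
  have [|T cT eT] := @mset_frankl0_star m k t _ le_tk; first by lia.
  by exists T; rewrite // eF r0.
move=> F i j s nij s1 optF [[r0 [X cX eX]]|[r0 [T cT eT]]|[X cX eX]].
- apply: Or31; split=> //.
  by apply: (frankl_shift_unique nij optF) s1 cX eX => //; lia.
- by apply: Or32; split=> //; apply: (star_shift_unique nij optF) cT eT.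
- by apply: Or33; apply: (frankl_shift_unique nij optF) s1 cX eX => //; lia.
Qed.

Lemma card_initial_frankl_succ r : 0 < t <= k -> r < k - t -> 2 * k <= m + t ->
  r.+1 * n = (k - t + 1) * (t + 2 * r + 1) ->
  #|initial_frankl r| = #|initial_frankl r.+1|.
Proof.
move=> tk rkt ktm eqn; have /andP[t0 le_tk] := tk.
rewrite /initial_frankl !card_mset_frankl; [|lia|lia|lia|lia].
apply: card_set_frankl_succ => //; rewrite ltnNge; apply/negP => le.
have h1 : r.+1 * n <= r.+1 * (2 * (k - t + 1) + t - 2) by rewrite leq_mul2l; lia.
have [u tE] : exists u, t = u.+1 by exists t.-1; lia.
have h2 : r.+1 * u <= (k - t + 1) * u by rewrite leq_mul2r; lia.
move: eqn h1; rewrite {2 4}tE; move: h2 rkt; move: (k - t) => K; clear; nia.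
Qed.

(* At t = 1 the bound n = 2k forces k <= 2: then a family with a member whose
   support is {x} lies in the star of x, any other lies in the triangle. *)
Lemma mset_intersection_boundary2 : k = 2 -> t = 1 -> m = 3 ->
  forall F, mset_family F -> #|F| <= #|initial_frankl 0| /\
    (#|F| = #|initial_frankl 0| -> is_mset_star F \/ is_mset_frankl 1 F).
Proof.
move=> k2 t1 m3 F [FU iF].
have [||T0 cT0 eT0] := @mset_frankl0_star m k t; [lia|lia|].
case: (boolP [exists A in F, #|msupp A| <= 1]) => [/existsP[A /andP[FA lt]]|/existsPn noA].
  have cA := kmset_card (subsetP FU _ FA).
  have [x eA] : exists x, msupp A = [set x].
    apply/cards1P; rewrite eqn_leq lt card_gt0 msupp_eq0 cA k2 //.
  pose T : ms := mset_fun k (fun y => y == x).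
  have TE y : T y = (y == x) :> nat by rewrite mset_funE // k2; case: (y == x).
  have cT : mcard T = t.
    rewrite /mcard (bigD1 x) //= TE eqxx big1 ?t1 // => y /negbTE ny.
    by rewrite TE ny.
  have sub : F \subset mset_star T.
    apply/subsetP => B FB; apply/mset_starP; first exact: (subsetP FU).
    move=> y; rewrite TE; case: eqP => // ->.
    have := iF _ _ FA FB; rewrite t1 /mcap (bigD1 x) //= big1 => [|z zx].
      by rewrite addn0 leq_min => /andP[].
    have : z \notin msupp A by rewrite eA inE.
    by rewrite in_msupp -leqNgt leqn0 => /eqP ->; rewrite min0n.
  have cS : #|initial_frankl 0| = #|mset_star T|.
    by rewrite /initial_frankl eT0; apply: card_mset_star cT0 cT.
  rewrite cS; split; first exact: subset_leq_card.
  move=> e; left; exists T => //; apply/eqP; by rewrite eqEcard sub e leqnn.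
have -> : #|initial_frankl 0| = #|initial_frankl 1|.
  by apply: card_initial_frankl_succ; rewrite k2 t1 ?m3.
have c3 : #|segment m (t + 2 * 1)| = t + 2 * 1 by rewrite card_segment //; lia.
have eX : segment m (t + 2 * 1) = setT.
  by apply/eqP; rewrite eqEcard subsetT cardsT card_ord c3 t1 m3.
have sub : F \subset initial_frankl 1.
  apply/subsetP => A FA; rewrite in_mset_frankl ?(subsetP FU) // eX setIT t1.
  by have := noA A; rewrite FA /= -ltnNge.
split; first exact: subset_leq_card.
move=> e; right; exists (segment m (t + 2 * 1)) => //.
by apply/eqP; rewrite eqEcard sub e leqnn.
Qed.

Lemma mset_intersection_boundary r : 0 < t <= k -> r < k - t -> 2 * k <= m + t ->
  r.+1 * n = (k - t + 1) * (t + 2 * r + 1) ->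
  forall F, mset_family F -> #|F| <= #|initial_frankl r| /\
    (#|F| = #|initial_frankl r| ->
       [\/ 0 < r /\ is_mset_frankl r F, r = 0 /\ is_mset_star F | is_mset_frankl r.+1 F]).
Proof.
move=> /andP[t0 le_tk] rkt ktm eqn F famF.
case: (ltngtP t 1) => [|t1|t1]; first by lia.
  by apply: mset_intersection_boundary_gt1 => //; rewrite t1.
(* For [t = 1] the threshold is 2k, so m = k + 1; then m >= 2k - 1 and r < k - 1 leave only k = 2, r
   = 0, m = 3. *)
have n2k : n = 2 * k.
  apply/eqP; rewrite -(eqn_pmul2l (ltn0Sn r)) eqn t1; apply/eqP.
  by rewrite subnK ?(leq_trans t0) //; nia.
have k2 : k = 2 by lia.
have r0 : r = 0 by lia.
have m3 : m = 3 by lia.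
have [le eq] := mset_intersection_boundary2 k2 t1 m3 famF.
by rewrite r0; split=> // /eq[star|frankl]; [apply: Or32|apply: Or33].
Qed.

(** Two [t]-multisets sharing [t] elements are equal, so [F] has at most one member. *)
Lemma mset_intersection_full : k = t -> t <= m -> forall F, mset_family F ->
  #|F| <= #|initial_frankl 0|.
Proof.
move=> kt tm F [FU iF].
have [|T cT eT] := @mset_frankl0_star m k t tm; first by lia.
have K0 : 0 < #|initial_frankl 0|.
  apply/card_gt0P; exists T; rewrite /initial_frankl eT.
  by apply/mset_starP; rewrite // in_kmset cT kt.
case: (set_0Vmem F) => [->|[A FA]]; first by rewrite cards0.
have sub B B' : B \in F -> B' \in F -> forall x, B x <= B' x.
  move=> FB FB' x; rewrite leqNgt; apply/negP => lt.
  suff : mcap B B' < mcard B.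
    by rewrite (kmset_card (subsetP FU _ FB)) [X in _ < X]kt ltnNge iF.
  rewrite /mcap /mcard (bigD1 x) //= [X in _ < X](bigD1 x) //= -addSn leq_add //.
    by rewrite (leq_trans _ lt) // ltnS geq_minr.
  by apply: leq_sum => y _; apply: geq_minl.
apply: leq_trans K0; rewrite -(cards1 A); apply: subset_leq_card.
apply/subsetP => B FB; rewrite inE; apply/eqP/mset_fun_eq => x.
by apply/eqP; rewrite eqn_leq !sub.
Qed.

(** The new case is r = k - t. There n = t + 2r + 1, hence m = k - t + 2, and m >= 2k - t forces k
    <= 2: either k = t, or k = 2, t = 1, m = 3. *)
Lemma mset_intersection_boundary_le r : 0 < t <= k -> r <= k - t -> 2 * k <= m + t ->
  r.+1 * n = (k - t + 1) * (t + 2 * r + 1) ->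
  forall F, mset_family F -> #|F| <= #|initial_frankl r|.
Proof.
move=> tk rkt ktm eqn F famF; have /andP[t0 le_tk] := tk.
case: (ltngtP r (k - t)) => [lt|gt|er]; [|lia|].
  by case: (mset_intersection_boundary tk lt ktm eqn famF).
have en : n = t + 2 * r + 1.
  apply/eqP; rewrite -(eqn_pmul2l (ltn0Sn r)) eqn; apply/eqP; congr (_ * _); lia.
case: (eqVneq k t) => [kt|nkt].
  have -> : r = 0 by lia.
  by apply: mset_intersection_full => //; lia.
have k2 : k = 2 by lia.
have t1 : t = 1 by lia.
have m3 : m = 3 by lia.
have -> : r = 1 by lia.
rewrite -card_initial_frankl_succ; [|lia|lia|lia|].
  by case: (mset_intersection_boundary2 k2 t1 m3 famF).
by rewrite k2 t1 m3.
Qed.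

End MultisetIntersection.

(** * Translation to the multiset library *)

Section Bridge.
Variables (m k : nat).
Local Notation ms := {ffun 'I_m -> 'I_k.+1}.
Implicit Types (A B : ms) (G H : {mset 'I_m}) (F : {fset {mset 'I_m}}) (x : 'I_m).

Lemma sum_count_mem (T : finType) (s : seq T) : \sum_(x : T) count_mem x s = size s.
Proof.
elim: s => [|y s IH] /=; first by rewrite big1.
rewrite big_split /= IH (bigD1 y) //= eqxx big1 // => x /negbTE nx.
by rewrite eq_sym nx.
Qed.

Lemma size_mset_sum G : size G = \sum_x G x.
Proof. by rewrite -sum_count_mem; apply: eq_bigr => x _; rewrite count_mem_mset. Qed.

Definition to_mset A : {mset 'I_m} :=
  seq_mset (flatten [seq nseq (A x) x | x <- enum 'I_m]).

Lemma to_msetE A x : to_mset A x = A x.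
Proof.
rewrite mset_seqE count_flatten -map_comp sumnE big_map big_enum /= (bigD1 x) //=.
rewrite count_nseq /= eqxx mul1n big1 ?addn0 // => y /negbTE ny.
by rewrite count_nseq /= ny.
Qed.

Definition of_mset G : ms := mset_fun k (fun x => G x).

Lemma of_msetE G x : size G <= k -> of_mset G x = G x :> nat.
Proof.
move=> Gk; rewrite mset_funE // (leq_trans _ Gk) // size_mset_sum.
by rewrite (bigD1 x) //= leq_addr.
Qed.

Lemma of_msetK G : size G <= k -> to_mset (of_mset G) = G.
Proof. by move=> Gk; apply/msetP => x; rewrite to_msetE of_msetE. Qed.

Lemma to_mset_inj : injective to_mset.
Proof. by move=> A B e; apply: mset_fun_eq => x; rewrite -!to_msetE e. Qed.

Lemma size_to_mset A : size (to_mset A) = mcard A.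
Proof. by rewrite size_mset_sum; apply: eq_bigr => x _; rewrite to_msetE. Qed.

Lemma size_to_msetI A B : size (to_mset A `&` to_mset B)%mset = mcap A B.
Proof.
by rewrite size_mset_sum; apply: eq_bigr => x _; rewrite msetE2 !to_msetE.
Qed.

Lemma mcard_of_mset G : size G <= k -> mcard (of_mset G) = size G.
Proof. by move=> Gk; rewrite -size_to_mset of_msetK. Qed.

Lemma to_mset_kmultisets A : (to_mset A \in kmultisets m k) = (A \in kmset m k).
Proof. by rewrite in_kmultisets size_to_mset in_kmset. Qed.

Definition of_fam F : {set ms} := [set A | to_mset A \in F].

Lemma in_of_fam F A : (A \in of_fam F) = (to_mset A \in F).
Proof. by rewrite inE. Qed.

Lemma of_famK F : (F `<=` kmultisets m k)%fset ->
  F = [fset to_mset A | A in of_fam F]%fset.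
Proof.
move=> /fsubsetP FU; apply/fsetP => G; apply/idP/imfsetP => /= [FG|[A + ->]]; last first.
  by rewrite in_of_fam.
have Gk : size (G : {mset 'I_m}) <= k by have := FU _ FG; rewrite in_kmultisets => /eqP ->.
by exists (of_mset G); rewrite ?in_of_fam of_msetK.
Qed.

Lemma of_fam_inj F F' : (F `<=` kmultisets m k)%fset -> (F' `<=` kmultisets m k)%fset ->
  of_fam F = of_fam F' -> F = F'.
Proof. by move=> /of_famK e /of_famK e' eF; rewrite e eF -e'. Qed.

Lemma card_of_fam F : (F `<=` kmultisets m k)%fset -> #|` F| = #|of_fam F|.
Proof.
move=> FU; rewrite [in LHS](of_famK FU) card_imfset /=; last exact: to_mset_inj.
by rewrite -cardE.
Qed.

Lemma of_fam_family t F : (F `<=` kmultisets m k)%fset -> t_intersecting t F ->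
  int_family (@mcap m k) (kmset m k) t (of_fam F).
Proof.
move=> /fsubsetP FU iF; split.
  by apply/subsetP => A; rewrite in_of_fam => /FU; rewrite to_mset_kmultisets.
by move=> A B; rewrite !in_of_fam => FA FB; rewrite -size_to_msetI; apply: iF.
Qed.

Lemma initial_setE l x : initial_set m l x = (x < l).
Proof.
rewrite mset_seqE count_uniq_mem; last by apply: filter_uniq; apply: enum_uniq.
by rewrite mem_filter mem_enum andbT.
Qed.

Lemma size_setI_initial A l :
  size (to_mset A `&` initial_set m l)%mset = #|msupp A :&: segment m l|.
Proof.
rewrite size_mset_sum -sum1_card [RHS]big_mkcond /=; apply: eq_bigr => x _.
rewrite msetE2 to_msetE initial_setE !inE.
by case: (x < l); rewrite ?andbT ?andbF ?minn0 //;
case: (nat_of_ord (A x)) => // a; rewrite minnSS minn0.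
Qed.

Lemma frankl_sub t r : (frankl_family m k t r `<=` kmultisets m k)%fset.
Proof. by apply/fsubsetP => G; rewrite !inE => /andP[]. Qed.

Lemma in_frankl t r G : (G \in frankl_family m k t r) =
  (size G == k) && (t + r <= size (G `&` initial_set m (t + 2 * r))%mset).
Proof. by rewrite !inE /= in_kmultisets. Qed.

Lemma of_fam_frankl t r : of_fam (frankl_family m k t r) = @initial_frankl m k t r.
Proof.
apply/setP => A; rewrite in_of_fam in_frankl size_to_mset size_setI_initial.
by rewrite !inE.
Qed.

Lemma card_frankl t r : #|` frankl_family m k t r| = #|@initial_frankl m k t r|.
Proof. by rewrite card_of_fam ?frankl_sub // of_fam_frankl. Qed.

Lemma permute_msetE (s : {perm 'I_m}) G x : permute_mset s G x = G (s^-1%g x).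
Proof.
rewrite mset_seqE count_map -count_mem_mset; apply: eq_count => y /=.
by rewrite (canF_eq (permK s)).
Qed.

Lemma size_permute_mset (s : {perm 'I_m}) G : size (permute_mset s G) = size G.
Proof.
rewrite !size_mset_sum [RHS](reindex_inj (@perm_inj _ s^-1%g)) /=.
by apply: eq_bigr => x _; rewrite permute_msetE.
Qed.

Lemma permute_mset_inj (s : {perm 'I_m}) : injective (permute_mset s).
Proof.
move=> G H e; apply/msetP => x.
by rewrite -(permK s x) -!permute_msetE e.
Qed.

Definition permute_fam (s : {perm 'I_m}) F := [fset permute_mset s G | G in F]%fset.

Lemma permute_fam_sub s F : (F `<=` kmultisets m k)%fset ->
  (permute_fam s F `<=` kmultisets m k)%fset.
Proof.
move=> /fsubsetP FU; apply/fsubsetP => _ /imfsetP[G /= FG ->].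
by rewrite in_kmultisets size_permute_mset -in_kmultisets FU.
Qed.

Lemma card_permute_fam s F : #|` permute_fam s F| = #|` F|.
Proof. by rewrite card_imfset //; exact: permute_mset_inj. Qed.

Lemma of_fam_permute_frankl s t r :
  of_fam (permute_fam s (frankl_family m k t r)) =
  mset_frankl k t r (s @: segment m (t + 2 * r)).
Proof.
apply/setP => A; rewrite in_of_fam.
pose G := permute_mset s^-1%g (to_mset A).
have -> : to_mset A = permute_mset s G.
  by apply/msetP => x; rewrite !permute_msetE invgK permKV.
rewrite (mem_imfset _ _ (@permute_mset_inj s)) /= in_frankl.
rewrite size_permute_mset size_to_mset !inE; congr (_ && (_ <= _)).
rewrite size_mset_sum -sum1_card [RHS]big_mkcond /= [RHS](reindex_inj (@perm_inj _ s)) /=.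
apply: eq_bigr => x _; rewrite msetE2 permute_msetE invgK to_msetE initial_setE.
rewrite !inE mem_imset ?inE; last exact: perm_inj.
by case: (x < _); rewrite ?andbT ?andbF ?minn0 //;
case: (nat_of_ord _) => // a; rewrite minnSS minn0.
Qed.

(** The images of [X] under permutations are closed under exchanges, hence include every set of the
    same size. *)
Lemma exists_perm_imset (X Y : {set 'I_m}) : #|X| = #|Y| ->
  exists s : {perm 'I_m}, Y = s @: X.
Proof.
move=> cXY; pose P (Z : {set 'I_m}) := [exists s : {perm 'I_m}, Z == s @: X].
have PT : swap_closed setT P.
  move=> A x y /existsP[s /eqP eA] _ _ xA yA; apply/existsP; exists (s * tperm y x)%g.
  apply/eqP; rewrite -(tperm_imset_swap xA yA) eA -imset_comp.
  by apply: eq_imset => z; rewrite /= permM.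
have /existsP[s /eqP ->] : P Y; last by exists s.
apply: (swap_closed_exchange PT _ _ cXY); last by rewrite !setDT.
by apply/existsP; exists 1%g; rewrite (eq_imset _ (@perm1 _)) imset_id.
Qed.

Lemma isomorphic_frankl t r F : (F `<=` kmultisets m k)%fset -> t + 2 * r <= m ->
  isomorphic F (frankl_family m k t r) <-> is_mset_frankl t r (of_fam F).
Proof.
move=> FU le_m; split=> [[s eF]|[X cX eX]].
  exists (s @: segment m (t + 2 * r)).
    by rewrite card_imset ?card_segment //; exact: perm_inj.
  by rewrite eF -of_fam_permute_frankl.
have [|s eXs] := @exists_perm_imset (segment m (t + 2 * r)) X.
  by rewrite card_segment.
exists s; apply: of_fam_inj => //; first by apply: permute_fam_sub; apply: frankl_sub.
by rewrite of_fam_permute_frankl eX eXs.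
Qed.

Lemma isomorphic_card F F' : isomorphic F F' -> #|` F| = #|` F'|.
Proof. by case=> s ->; apply: card_permute_fam. Qed.

Lemma containing_star t F : (F `<=` kmultisets m k)%fset -> t <= k ->
  all_containing_fixed k t F <-> is_mset_star t (of_fam F).
Proof.
have star_mem (T : {mset 'I_m}) A : size T <= k ->
    (A \in mset_star (of_mset T)) = (to_mset A \in kmultisets m k) && (T `<=` to_mset A)%mset.
  move=> Tk; rewrite to_mset_kmultisets inE; congr (_ && _).
  apply/forallP/msubsetP => h x; have := h x; by rewrite of_msetE // to_msetE.
move=> FU tk; split=> [[T sT eF]|[T cT eT]].
  exists (of_mset T); first by rewrite mcard_of_mset sT.
  by apply/setP => A; rewrite in_of_fam eF star_mem ?sT // !inE.
exists (to_mset T); first by rewrite size_to_mset.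
apply: of_fam_inj => //; first by apply/fsubsetP => G; rewrite !inE => /andP[].
have sT : size (to_mset T) <= k by rewrite size_to_mset cT.
have eTT : of_mset (to_mset T) = T by apply: to_mset_inj; rewrite of_msetK.
by rewrite eT; apply/setP => A; rewrite -{1}eTT star_mem // in_of_fam !inE.
Qed.

Lemma card_containing t F : (F `<=` kmultisets m k)%fset -> t <= k -> t <= m ->
  all_containing_fixed k t F -> #|` F| = #|` frankl_family m k t 0|.
Proof.
move=> FU tk tm /(containing_star FU tk)[T cT eT].
have [T0 cT0 eT0] := mset_frankl0_star tm tk.
by rewrite card_of_fam // eT card_frankl /initial_frankl eT0; apply: card_mset_star cT cT0.
Qed.

End Bridge.

(** * Clearing denominators in the thresholds *)

Section Threshold.
Import GRing.Theory Num.Theory.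
Local Open Scope ring_scope.

Lemma threshold_mul (k t s : nat) : (0 < t <= k)%N -> (0 < s)%N ->
  threshold k t s * s%:R = ((k - t + 1) * (t + 2 * s - 1))%N%:R.
Proof.
move=> /andP[t0 tk] s0; have s_neq0 : (s%:R : rat) != 0 by rewrite pnatr_eq0 -lt0n.
rewrite /threshold natrM natrD natrB // -mulrA; congr (_ * _).
by rewrite mulrDl divfK // natrB ?addn_gt0 ?t0 // natrD natrM addrCA addrA.
Qed.

Lemma natr_predD (m k : nat) : (0 < k)%N -> (m%:R + k%:R - 1 : rat) = (m + k.-1)%N%:R.
Proof. by case: k => // k _; rewrite natrD -addrA -natr1 addrK. Qed.

Lemma threshold_lt (k t s N : nat) : (0 < t <= k)%N -> (0 < s)%N ->
  (threshold k t s < N%:R) = ((k - t + 1) * (t + 2 * s - 1) < s * N)%N.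
Proof.
move=> tk s0; have s_gt0 : (0 : rat) < s%:R by rewrite ltr0n.
by rewrite -(ltr_pM2r s_gt0) threshold_mul // -natrM ltr_nat mulnC [(N * s)%N]mulnC.
Qed.

Lemma lt_threshold (k t s N : nat) : (0 < t <= k)%N -> (0 < s)%N ->
  (N%:R < threshold k t s) = (s * N < (k - t + 1) * (t + 2 * s - 1))%N.
Proof.
move=> tk s0; have s_gt0 : (0 : rat) < s%:R by rewrite ltr0n.
by rewrite -(ltr_pM2r s_gt0) threshold_mul // -natrM ltr_nat mulnC.
Qed.

Lemma eq_threshold (k t s N : nat) : (0 < t <= k)%N -> (0 < s)%N ->
  N%:R = threshold k t s -> (s * N = (k - t + 1) * (t + 2 * s - 1))%N.
Proof.
move=> tk s0 eN; apply/eqP; rewrite -(eqr_nat rat) natrM mulrC eN.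
by rewrite threshold_mul.
Qed.
End Threshold.

(** The guard [0 < r] on the upper bound stands for the infinite threshold at [r = 0]. At the
    threshold with r = k - t, membership in F_(r+1) would require k + 1 common elements, so that
    family is empty; the equalities there are stated for r < k - t, and the bound for all [r]. *)
Theorem theorem4p1 (t k r m : nat) (F : {fset {mset 'I_m}}) :
  (1 <= t <= k)%N -> (r <= k - t)%N -> (2 * k - t <= m)%N ->
  (F `<=` kmultisets m k)%fset -> t_intersecting t F ->
  ((threshold k t r.+1 < m%:R + k%:R - 1)%R ->
   ((0 < r)%N -> (m%:R + k%:R - 1 < threshold k t r)%R) ->
     (#|` F| <= #|` frankl_family m k t r|)%N
     /\ ((0 < r)%N ->
           (#|` F| = #|` frankl_family m k t r|
            <-> isomorphic F (frankl_family m k t r)))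
     /\ (r = 0%N ->
           (#|` F| = #|` frankl_family m k t r|
            <-> all_containing_fixed k t F)))
  /\
  ((m%:R + k%:R - 1 = threshold k t r.+1)%R ->
     (#|` F| <= #|` frankl_family m k t r|)%N
     /\ ((r < k - t)%N ->
           #|` frankl_family m k t r| = #|` frankl_family m k t r.+1|
           /\ ((0 < r)%N ->
                 (#|` F| = #|` frankl_family m k t r|
                  <-> isomorphic F (frankl_family m k t r)
                      \/ isomorphic F (frankl_family m k t r.+1)))
           /\ (r = 0%N ->
                 (#|` F| = #|` frankl_family m k t r|
                  <-> isomorphic F (frankl_family m k t 1)
                      \/ all_containing_fixed k t F)))).
Proof.
move=> tk rkt ktm FU iF; have /andP[t0 le_tk] := tk.
have k0 : 0 < k by lia.
have ktm' : 2 * k <= m + t by lia.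
have le_m : t + 2 * r <= m by lia.
have famF := of_fam_family FU iF.
have e1 : t + 2 * r.+1 - 1 = t + 2 * r + 1 by lia.
rewrite natr_predD // threshold_lt // e1; split=> [lower upper|/(eq_threshold tk (ltn0Sn r))].
  have {}upper : 0 < r -> r * (m + k.-1) < (k - t + 1) * (t + 2 * r - 1).
    by move=> r0; move: (upper r0); rewrite lt_threshold.
  have [le eq] := mset_intersection_strict tk rkt ktm' lower upper famF.
  rewrite (card_of_fam FU) card_frankl; split=> //; split=> r0; split.
  - by case/eq => /(_ r0) H _; apply/isomorphic_frankl.
  - by move=> iso; rewrite -card_of_fam // -card_frankl; apply: isomorphic_card.
  - by case/eq => _ /(_ r0) H; apply/containing_star.
  - move=> star; rewrite -card_of_fam // -card_frankl r0.
    by apply: card_containing => //; lia.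
rewrite e1 => eqn; rewrite (card_of_fam FU) !card_frankl; split.
  exact: (mset_intersection_boundary_le tk rkt ktm' eqn famF).
move=> ltr; have le_m1 : t + 2 * r.+1 <= m by lia.
have card_eq := card_initial_frankl_succ tk ltr ktm' eqn.
have [le eq] := mset_intersection_boundary tk ltr ktm' eqn famF.
split=> //; split=> r0; split.
- case/eq => [[_ H]|[r00]|H]; [left|by lia|right]; exact/isomorphic_frankl.
- by case=> /isomorphic_card eF; rewrite -card_of_fam // eF card_frankl -?card_eq.
- case/eq => [[]|[_ H]|H]; [by lia|right|left]; first exact/containing_star.
  by rewrite r0 in H le_m1; apply/isomorphic_frankl.
- case=> [iso|star]; rewrite -card_of_fam //.
    by rewrite card_eq -card_frankl r0; apply: isomorphic_card.
  by rewrite -card_frankl r0; apply: card_containing => //; lia.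
Qed.
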